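(* Let $p$ be a prime, let $d\ge 1$ be an integer, and let $a\in\mathbb{Q}$ satisfy: (i) $a\in N^{-1}\mathbb{Z}$ for some integer $N\ge 2$ with $p\nmid N$ (so that $a\in\mathbb{Z}_p$); (ii) $0<a<1$. Let $l\in\{0,\ldots,p-1\}$ be the unique integer with $a+l\equiv 0\pmod{p}$, and write $\underline{a}=(a,\ldots,a)\in\mathbb{Z}_p^{d+1}$. If $p$ is odd, then $$\mathscr{F}^{\rm Dw}_{\underline{a}}(t)=((-1)^{d+1}t)^l\,\mathscr{F}^{\rm Dw}_{\underline{a}}(t^{-1})$$ in $\mathbb{Z}_p\langle t,t^{-1},h_{\underline{a}}(t)^{-1}\rangle$. If $p=2$, then $\mathscr{F}^{\rm Dw}_{\underline{a}}(t)=\pm((-1)^{d+1}t)^l\,\mathscr{F}^{\rm Dw}_{\underline{a}}(t^{-1})$ for some sign; moreover, for $p=2$, the equality $$\mathscr{F}^{\rm Dw}_{\underline{a}}(t)=-((-1)^{d+1}t)^l\,\mathscr{F}^{\rm Dw}_{\underline{a}}(t^{-1})$$ holds if and only if $d$ is even and $a'\equiv 1\pmod{2}$ (where $a'$ is the Dwork prime of $a$).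
   Context: For $b\in\mathbb{Z}_p$, the Dwork prime is $b'=(b+k)/p$, where $k\in\{0,\ldots,p-1\}$ is the unique integer with $b+k\equiv 0\pmod p$; set $b^{(0)}=b$, $b^{(i)}=(b^{(i-1)})'$, and apply these componentwise to tuples $\underline{b}=(b_0,\ldots,b_d)\in\mathbb{Z}_p^{d+1}$. Let $(b)_n=b(b+1)\cdots(b+n-1)$ and $F_{\underline{b}}(t)=\sum_{n\ge0}\frac{(b_0)_n\cdots(b_d)_n}{(n!)^{d+1}}t^n\in\mathbb{Z}_p[[t]]$. Dwork's $p$-adic hypergeometric function is $\mathscr{F}^{\rm Dw}_{\underline{b}}(t)=F_{\underline{b}}(t)/F_{\underline{b}'}(t^p)\in\mathbb{Z}_p[[t]]$. For a power series $f=\sum c_nt^n$, $[f(t)]_{<m}=\sum_{n<m}c_nt^n$. Choose $M$ large enough that the set $\{\overline{[F_{\underline{b}^{(i)}}(t)]_{<p}}\}_{i\ge0}$ of reductions mod $p$ in $\mathbb{F}_p[t]$ equals $\{\overline{[F_{\underline{b}^{(i)}}(t)]_{<p}}\}_{0\le i\le M}$, and set $h_{\underline{b}}(t)=\prod_{i=1}^M[F_{\underline{b}^{(i)}}(t)]_{<p}$. Put $\mathbb{Z}_p\langle t,t^{-1},h_{\underline{b}}(t)^{-1}\rangle=\varprojlim_n(\mathbb{Z}_p/p^n)[t,t^{-1},h_{\underline{b}}(t)^{-1}]$. By Dwork's congruence $\mathscr{F}^{\rm Dw}_{\underline{b}}(t)\equiv [F_{\underline{b}}(t)]_{<p^n}/[F_{\underline{b}'}(t^p)]_{<p^n}\pmod{p^n}$,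 $\mathscr{F}^{\rm Dw}_{\underline{b}}(t)$ defines an element of $\varprojlim_n(\mathbb{Z}_p/p^n)[t,h_{\underline{b}}(t)^{-1}]$, hence of $\mathbb{Z}_p\langle t,t^{-1},h_{\underline{b}}(t)^{-1}\rangle$. It is known that $\mathbb{Z}_p\langle t,t^{-1},h_{\underline{b}}(t^{-1})^{-1}\rangle=\mathbb{Z}_p\langle t,t^{-1},h_{\underline{b}}(t)^{-1}\rangle$, so $t\mapsto t^{-1}$ defines an involution $\iota$ of this ring; $\mathscr{F}^{\rm Dw}_{\underline{b}}(t^{-1})$ means $\iota(\mathscr{F}^{\rm Dw}_{\underline{b}}(t))$.
   Formalization: M is taken large enough that the reductions for 1≤i≤M (the indices in the product h), rather than 0≤i≤M, already give all reductions for i≥0; otherwise, e.g. for a=1/2 and M=0, h=1 and Dwork's function is not in the ring. *)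

(* Defs.v *)
From HB Require Import structures.
From mathcomp Require Import all_boot all_order all_algebra generic_quotient.
From mathcomp Require Import ring_quotient boolp classical_sets functions.

Set Implicit Arguments.
Unset Strict Implicit.
Unset Printing Implicit Defensive.

Import GRing.Theory.
Local Open Scope ring_scope.
Local Open Scope quotient_scope.

Definition eqmod (A : comPzRingType) (m x y : A) : Prop :=
  exists q : A, x = y + m * q.

(* Classical inverses: x^-1 is the inverse of x if there is one, x otherwise. *)
Section ClassicalInverse.
Variable A : comNzRingType.

Definition cunit : {pred A} := fun x => `[< exists y, y * x = 1 >].

Definition cinv (x : A) : A := xget x [set y | y * x = 1].

Lemma mulVc : {in cunit, left_inverse 1 cinv *%R}.
Proof. by move=> x /asboolP ex; rewrite /cinv; apply: (xgetPex x ex). Qed.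

Lemma cunitPl (x y : A) : y * x = 1 -> cunit x.
Proof. by move=> yx; apply/asboolP; exists y. Qed.

Lemma cinv_out : {in [predC cunit], cinv =1 id}.
Proof.
move=> x /asboolPn nex; rewrite /cinv; case: xgetP => // y _ yx.
by case: nex; exists y.
Qed.

End ClassicalInverse.

Section Ideal.
Variables (A : comPzRingType) (s : seq A).

Definition ideal : {pred A} :=
  fun x => `[< exists c : nat -> A, x = \sum_(i < size s) c i * s`_i >].

Lemma ideal_zmod : zmod_closed ideal.
Proof.
split; first by apply/asboolP; exists (fun=> 0); rewrite big1 // => i; rewrite mul0r.
move=> x y /asboolP[c ->] /asboolP[e ->]; apply/asboolP.
by exists (fun i => c i - e i); rewrite -sumrB; apply: eq_bigr => i; rewrite mulrBl.
Qed.

HB.instance Definition _ := GRing.isZmodClosed.Build A ideal ideal_zmod.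

Lemma idealMl (a x : A) : x \in ideal -> a * x \in ideal.
Proof.
move=> /asboolP[c ->]; apply/asboolP; exists (fun i => a * c i).
by rewrite mulr_sumr; apply: eq_bigr => i _; rewrite mulrA.
Qed.

(* ring_quotient only makes a ring of the quotient by a proper ideal. *)
Definition qring := Quotient.quot ideal.

HB.instance Definition _ := GRing.Zmodule.on qring.

Definition to_q (x : A) : qring := \pi_qring x.

Lemma to_q_eqP (x y : A) : reflect (to_q x = to_q y) (x - y \in ideal).
Proof. by rewrite Quotient.idealrBE; apply: eqP. Qed.

Lemma to_q_surj (u : qring) : exists x, to_q x = u.
Proof. by exists (repr u); rewrite /to_q reprK. Qed.

Lemma to_q_is_zmod : zmod_morphism to_q.
Proof. by move=> x y; rewrite /to_q !piE. Qed.

HB.instance Definition _ := GRing.isZmodMorphism.Build A qring to_q to_q_is_zmod.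

Definition qmul (u v : qring) : qring := to_q (repr u * repr v).

Lemma to_qM : {morph to_q : x y / x * y >-> qmul x y}.
Proof.
have E x : x - repr (to_q x) \in ideal by apply/to_q_eqP; rewrite /to_q reprK.
move=> x y; apply/to_q_eqP.
rewrite -[x * y](addrNK (x * repr (to_q y))) -mulrBr -addrA -mulrBl.
by apply: rpredD; [|rewrite mulrC]; apply: idealMl.
Qed.

Lemma qmulA : associative qmul.
Proof.
move=> u v w; have [x <-] := to_q_surj u; have [y <-] := to_q_surj v.
by have [z <-] := to_q_surj w; rewrite -!to_qM mulrA.
Qed.

Lemma qmulC : commutative qmul.
Proof. by move=> u v; rewrite /qmul mulrC. Qed.

Lemma qmul1 : left_id (to_q 1) qmul.
Proof. by move=> u; have [x <-] := to_q_surj u; rewrite -to_qM mul1r. Qed.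

Lemma qmulDl : left_distributive qmul +%R.
Proof.
move=> u v w; have [x <-] := to_q_surj u; have [y <-] := to_q_surj v.
by have [z <-] := to_q_surj w; rewrite -raddfD -!to_qM mulrDl raddfD.
Qed.

HB.instance Definition _ :=
  GRing.Zmodule_isComPzRing.Build qring qmulA qmulC qmul1 qmulDl.

Lemma to_q_is_monoid : monoid_morphism to_q.
Proof. by split; last exact: to_qM. Qed.

HB.instance Definition _ :=
  GRing.isMonoidMorphism.Build A qring to_q to_q_is_monoid.

End Ideal.

(* The inverse limit of the rings A / (s n), where the ideals (s n) decrease:
   the transition map sends the class of g modulo (s n.+1) to its class modulo
   (s n). *)
Section InverseLimit.
Variables (A : comPzRingType) (s : nat -> seq A).

Definition coherent (x : forall n, qring (s n)) : Prop :=
  forall n, exists g : A, x n.+1 = to_q _ g /\ x n = to_q _ g.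

Record ilim := Ilim { proj :> forall n, qring (s n) ; projP : `[< coherent proj >] }.

HB.instance Definition _ := [isSub for proj].
HB.instance Definition _ := [Choice of ilim by <:].

Lemma ilimP (x y : ilim) : (forall n, x n = y n) -> x = y.
Proof. by move=> xy; apply/val_inj/functional_extensionality_dep. Qed.

Lemma coh_cst (a : A) : `[< coherent (fun n => to_q (s n) a) >].
Proof. by apply/asboolP => n; exists a. Qed.

Lemma coh_opp (x : ilim) : `[< coherent (fun n => - x n) >].
Proof.
apply/asboolP => n; have /asboolP/(_ n)[g [E1 E2]] := projP x.
by exists (- g); rewrite !raddfN E1 E2.
Qed.

Lemma coh_add (x y : ilim) : `[< coherent (fun n => x n + y n) >].
Proof.
apply/asboolP => n; have /asboolP/(_ n)[g [E1 E2]] := projP x.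
have /asboolP/(_ n)[h [E3 E4]] := projP y.
by exists (g + h); rewrite !raddfD E1 E2 E3 E4.
Qed.

Lemma coh_mul (x y : ilim) : `[< coherent (fun n => x n * y n) >].
Proof.
apply/asboolP => n; have /asboolP/(_ n)[g [E1 E2]] := projP x.
have /asboolP/(_ n)[h [E3 E4]] := projP y.
by exists (g * h); rewrite !rmorphM E1 E2 E3 E4.
Qed.

Definition to_lim (a : A) : ilim := Ilim (coh_cst a).

Lemma ilimA : associative (fun x y => Ilim (coh_add x y)).
Proof. by move=> x y z; apply: ilimP => n /=; rewrite addrA. Qed.

Lemma ilimC : commutative (fun x y => Ilim (coh_add x y)).
Proof. by move=> x y; apply: ilimP => n /=; rewrite addrC. Qed.

Lemma ilim0 : left_id (to_lim 0) (fun x y => Ilim (coh_add x y)).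
Proof. by move=> x; apply: ilimP => n /=; rewrite raddf0 add0r. Qed.

Lemma ilimN :
  left_inverse (to_lim 0) (fun x => Ilim (coh_opp x)) (fun x y => Ilim (coh_add x y)).
Proof. by move=> x; apply: ilimP => n /=; rewrite raddf0 addNr. Qed.

HB.instance Definition _ := GRing.isZmodule.Build ilim ilimA ilimC ilim0 ilimN.

Lemma ilimMA : associative (fun x y => Ilim (coh_mul x y)).
Proof. by move=> x y z; apply: ilimP => n /=; rewrite mulrA. Qed.

Lemma ilimMC : commutative (fun x y => Ilim (coh_mul x y)).
Proof. by move=> x y; apply: ilimP => n /=; rewrite mulrC. Qed.

Lemma ilimM1 : left_id (to_lim 1) (fun x y => Ilim (coh_mul x y)).
Proof. by move=> x; apply: ilimP => n /=; rewrite rmorph1 mul1r. Qed.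

Lemma ilimMDl : left_distributive (fun x y => Ilim (coh_mul x y)) +%R.
Proof. by move=> x y z; apply: ilimP => n /=; rewrite mulrDl. Qed.

HB.instance Definition _ :=
  GRing.Zmodule_isComPzRing.Build ilim ilimMA ilimMC ilimM1 ilimMDl.

Lemma to_lim_is_zmod : zmod_morphism to_lim.
Proof. by move=> a c; apply: ilimP => n /=; rewrite raddfB. Qed.

Lemma to_lim_is_monoid : monoid_morphism to_lim.
Proof. by split=> [|a c] //; apply: ilimP => n /=; rewrite rmorphM. Qed.

HB.instance Definition _ := GRing.isZmodMorphism.Build A ilim to_lim to_lim_is_zmod.
HB.instance Definition _ :=
  GRing.isMonoidMorphism.Build A ilim to_lim to_lim_is_monoid.

End InverseLimit.

(* Formal power series over A, as sequences of coefficients. *)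
Section PowerSeries.
Variable A : comNzRingType.

Definition pseries := nat -> A.

HB.instance Definition _ := GRing.Zmodule.copy pseries (nat -> A).

Definition ps_trunc (m : nat) (f : pseries) : {poly A} := \poly_(i < m) f i.

Definition of_poly (g : {poly A}) : pseries := fun i => g`_i.

(* f(t) |-> f(t^k) *)
Definition ps_expand (k : nat) (f : pseries) : pseries :=
  fun i => if (k %| i)%N then f (i %/ k)%N else 0.

Definition psmul (f g : pseries) : pseries :=
  fun n => \sum_(i < n.+1) f i * g (n - i)%N.

Lemma psmulE (m n : nat) (f g : pseries) :
  (n < m)%N -> psmul f g n = (ps_trunc m f * ps_trunc m g)`_n.
Proof.
move=> nm; rewrite coefM; apply: eq_bigr => i _; rewrite !coef_poly.
by rewrite (leq_ltn_trans (leq_ord i) nm) (leq_ltn_trans (leq_subr _ _) nm).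
Qed.

Lemma psmulC : commutative psmul.
Proof. by move=> f g; apply/funext => n; rewrite !(psmulE _ _ (ltnSn n)) mulrC. Qed.

Lemma psmulA : associative psmul.
Proof.
move=> f g k; apply/funext => n.
have E u v (i : 'I_n.+1) : psmul u v i = (ps_trunc n.+1 u * ps_trunc n.+1 v)`_i.
  exact: psmulE.
transitivity ((ps_trunc n.+1 f * (ps_trunc n.+1 g * ps_trunc n.+1 k))`_n).
  rewrite coefM; apply: eq_bigr => i _; rewrite coef_poly ltn_ord.
  by rewrite (psmulE (m := n.+1)) // ltnS leq_subr.
rewrite mulrA coefM; apply: eq_bigr => i _; rewrite E coef_poly.
by rewrite ltnS leq_subr.
Qed.

Definition ps1 : pseries := of_poly 1.

Lemma psmul1 : left_id ps1 psmul.
Proof.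
move=> f; apply/funext => n; rewrite /psmul big_ord_recl /ps1 /of_poly.
rewrite coef1 mul1r subn0 big1 ?addr0// => i _.
by rewrite coef1 mul0r.
Qed.

Lemma psmulDl : left_distributive psmul +%R.
Proof.
move=> f g k; apply/funext => n; rewrite -[RHS]/(psmul f k n + psmul g k n).
by rewrite /psmul -big_split; apply: eq_bigr => i _; apply: mulrDl.
Qed.

Lemma ps1_neq0 : ps1 != 0.
Proof.
apply/eqP => /(congr1 (fun f : pseries => f 0%N)) /eqP.
by rewrite /ps1 /of_poly coef1 /= (negPf (oner_neq0 A)).
Qed.

HB.instance Definition _ := GRing.Zmodule_isComNzRing.Build pseries
  psmulA psmulC psmul1 psmulDl ps1_neq0.
HB.instance Definition _ := GRing.ComNzRing_hasMulInverse.Build pseries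
  (@mulVc pseries) (@cunitPl pseries) (@cinv_out pseries).

End PowerSeries.

(* The p-adic integers. The argument p_pr is there for the instance of nontrivial
   ring, on which the ring of polynomials depends. *)
Definition padic {p : nat} (p_pr : prime p) := ilim (fun n => [:: (p ^ n)%:Z]).

Section Padic.
Variables (p : nat) (p_pr : prime p).
Local Notation Zp := (padic p_pr).

HB.instance Definition _ := GRing.ComPzRing.on Zp.

Lemma padic1_neq0 : (1 : Zp) != 0.
Proof.
apply/eqP => /(congr1 (fun x : Zp => proj x 1%N)) /= /to_q_eqP /asboolP[c].
rewrite subr0 big_ord_recl big_ord0 addr0 /= expn1 => E.
move/eqP: (congr1 absz E); rewrite abszM eq_sym muln_eq1 => /andP[_ /eqP /= p1].
by move: p_pr; rewrite p1.
Qed.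

HB.instance Definition _ := GRing.PzSemiRing_isNonZero.Build Zp padic1_neq0.
HB.instance Definition _ := GRing.ComNzRing_hasMulInverse.Build Zp
  (@mulVc Zp) (@cunitPl Zp) (@cinv_out Zp).

(* Exact division: the z with z * y = x; Zp is torsion-free, so there is at most
   one if y is a nonzero natural number, the only case used below. *)
Definition exact_div (x y : Zp) : Zp := xget 0 [set z | z * y = x].

Definition dwork_digit (x : Zp) : nat :=
  xget 0%N [set k : nat | (k < p)%N /\ eqmod p%:R (x + k%:R) 0].

Definition dwork_prime (x : Zp) : Zp :=
  exact_div (x + (dwork_digit x)%:R) p%:R.

Definition poch (x : Zp) (n : nat) : Zp := \prod_(j < n) (x + j%:R).

Section Hypergeometric.
Variable d : nat.
Implicit Types b : 'I_d.+1 -> Zp.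

Definition dwork_primes b : 'I_d.+1 -> Zp := fun i => dwork_prime (b i).

Definition hyperg b : pseries Zp :=
  fun n => exact_div (\prod_i poch (b i) n) ((n`!)%:R ^+ d.+1).

Definition dwork_series b : pseries Zp :=
  hyperg b / ps_expand p (hyperg (dwork_primes b)).

(* [F_{b^(i)}(t)]_{<p} *)
Definition hyperg_lt b (i : nat) : {poly Zp} :=
  ps_trunc p (hyperg (iter i dwork_primes b)).

(* Every reduction modulo p of an [F_{b^(i)}(t)]_{<p} is the reduction of one
   of the factors of hpoly b M. *)
Definition large_enough b (M : nat) : Prop :=
  forall i, exists2 j, (1 <= j <= M)%N &
    eqmod p%:R (hyperg_lt b i) (hyperg_lt b j).

Definition hpoly b (M : nat) : {poly Zp} := \prod_(1 <= i < M.+1) hyperg_lt b i.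

End Hypergeometric.

(* padic_t h is Zp<t, t^-1, h^-1>: since inverting t and h amounts to inverting
   t * h, the ring (Zp/p^n)[t, t^-1, h^-1] is the quotient of Zp[t][X] by the
   ideal (p^n, t * h * X - 1). *)
Definition padic_t (h : {poly Zp}) :=
  @ilim {poly {poly Zp}} (fun n => [:: (p ^ n)%:R; ('X * h)%:P * 'X - 1]).

Section CompletedRing.
Variable h : {poly Zp}.

HB.instance Definition _ := GRing.ComPzRing.on (padic_t h).

Definition poly_padic_t (g : {poly Zp}) : padic_t h := to_lim _ g%:P.

Definition tvar : padic_t h := poly_padic_t 'X.

(* The endomorphism induced by t |-> t^-1 on every (Zp/p^n)[t, t^-1, h^-1]; it
   exists when the inverse of h(t) may be replaced with that of h(t^-1), and is
   unique. *)
Definition tinv : padic_t h -> padic_t h :=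
  xget (fun x : padic_t h => x) [set f : padic_t h -> padic_t h |
    [/\ zmod_morphism f, monoid_morphism f, f tvar * tvar = 1 &
        forall n (x y : padic_t h), proj x n = proj y n -> proj (f x) n = proj (f y) n]].

End CompletedRing.

(* The element of Zp<t, t^-1, h^-1> that the power series dwork_series b defines:
   modulo p^n it is a fraction g / h^k with g in Zp[t], i.e. an element of
   (Zp/p^n)[t, h^-1], whose expansion in (Zp/p^n)[[t]] is dwork_series b. As h(0)
   is a unit, at most one element has this property. *)
Definition dwork_fun (d : nat) (b : 'I_d.+1 -> Zp) (M : nat) : padic_t (hpoly b M) :=
  let h := hpoly b M in
  xget 0 [set D : padic_t h | forall n, exists (g : {poly Zp}) (k : nat),
    proj D n * proj (poly_padic_t h (h ^+ k)) n = proj (poly_padic_t h g) n /\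
    eqmod (p ^ n)%:R (dwork_series b * of_poly (h ^+ k)) (of_poly g)].

End Padic.

Arguments tinv {p p_pr h}.
Arguments tvar {p p_pr h}.

(* Main.v *)
(* For a = - L with L a natural number, F_a(t) is the polynomial
   P_L(t) = sum_k ((-1)^k 'C(L, k))^(d+1) t^k, which is palindromic up to a power of
   (-1)^(d+1), and the Dwork prime of - L is - (L %/ p). So the transformation formula
   for P_L(t) / P_(L %/ p)(t^p) is immediate, the sign being ((-1)^(d+1))^(L + L %/ p).
   It passes to a general p-adic integer a because P_L(t) / P_(L %/ p)(t^p) mod p^n
   depends only on L mod p^n and equals the Dwork function mod p^n when L = - a mod p^n.

   This dependence is a Dwork congruence, proved as in Mellit-Vlasenko: P_L is the
   diagonal of La^L for La = prod_i (1 - X_i), and the powers La^L with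
   L = M mod p^s have a common expansion
   La^L = sum_j c_j sigma^(j+1)(La^(L %/ p^(j+1))) mod p^s, where sigma raises the
   variables to the power p, p^j divides c_j, and c_j has degree < p^(j+1) in every
   variable. The last property makes the diagonal multiplicative on the terms. *)

From HB Require Import structures.
Require Import Defs.
From mathcomp Require Import all_boot all_order all_algebra.
From mathcomp Require Import boolp classical_sets mpoly.

Set Implicit Arguments.
Unset Strict Implicit.
Unset Printing Implicit Defensive.

Import GRing.Theory Num.Theory.
Local Open Scope ring_scope.

(** * Congruences and the common expansion of powers *)

Section Eqmod.
Variable A : comPzRingType.
Implicit Types m x y z : A.

Lemma eqmod_refl m x : eqmod m x x.
Proof. by exists 0; rewrite mulr0 addr0. Qed.

Lemma eqmod_sym m x y : eqmod m x y -> eqmod m y x.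
Proof. by case=> q ->; exists (- q); rewrite mulrN addrK. Qed.

Lemma eqmod_trans m x y z : eqmod m x y -> eqmod m y z -> eqmod m x z.
Proof. by case=> q -> [r ->]; exists (r + q); rewrite mulrDr addrA. Qed.

Lemma eqmodD m x y z t : eqmod m x y -> eqmod m z t -> eqmod m (x + z) (y + t).
Proof. by case=> q -> [r ->]; exists (q + r); rewrite mulrDr addrACA. Qed.

Lemma eqmodN m x y : eqmod m x y -> eqmod m (- x) (- y).
Proof. by case=> q ->; exists (- q); rewrite mulrN opprD. Qed.

Lemma eqmodB0 m x y : eqmod m x y <-> eqmod m (x - y) 0.
Proof.
split; case=> q E; exists q; first by rewrite E addrC addKr add0r.
by rewrite -[x](subrK y) E add0r addrC.
Qed.

Lemma eqmodMl m c x y : eqmod m x y -> eqmod m (c * x) (c * y).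
Proof. by case=> q ->; exists (c * q); rewrite mulrDr mulrCA. Qed.

Lemma eqmodMr m c x y : eqmod m x y -> eqmod m (x * c) (y * c).
Proof. by rewrite ![_ * c]mulrC; apply: eqmodMl. Qed.

Lemma eqmodM m x y z t : eqmod m x y -> eqmod m z t -> eqmod m (x * z) (y * t).
Proof.
by move=> xy zt; apply: (@eqmod_trans _ _ (y * z)); [apply: eqmodMr|apply: eqmodMl].
Qed.

Lemma eqmodX m k x y : eqmod m x y -> eqmod m (x ^+ k) (y ^+ k).
Proof.
move=> xy; elim: k => [|k IH]; first exact: eqmod_refl.
by rewrite !exprS; apply: eqmodM.
Qed.

Lemma eqmod_sum m (I : Type) (r : seq I) (P : pred I) (f g : I -> A) :
  (forall i, P i -> eqmod m (f i) (g i)) ->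
  eqmod m (\sum_(i <- r | P i) f i) (\sum_(i <- r | P i) g i).
Proof.
move=> fg; elim/big_rec2: _ => [|i x y Pi xy]; first exact: eqmod_refl.
by apply: eqmodD; [exact: fg|].
Qed.

Lemma eqmod_dvd m k x y : eqmod (m * k) x y -> eqmod m x y.
Proof. by case=> q ->; exists (k * q); rewrite mulrA. Qed.

(** In the expansions below the [j]-th coefficient is divisible by [p ^ j], so its cofactor is
    needed only to the remaining precision. *)
Lemma eqmod_mul0 m (n : A) c x y : eqmod m c 0 -> eqmod n x y ->
  eqmod (m * n) (c * x) (c * y).
Proof.
case=> q ->; rewrite add0r => -[r ->]; exists (q * r).
by rewrite mulrDr mulrACA.
Qed.

Lemma eqmod_expn (p k n : nat) x y : (n <= k)%N ->
  eqmod (p ^ k)%:R x y -> eqmod (p ^ n)%:R x y.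
Proof. by move=> nk; rewrite -(subnKC nk) expnD natrM => /eqmod_dvd. Qed.

Lemma eqmod_exp0 (p : nat) x y : eqmod (p ^ 0)%:R x y.
Proof. by exists (x - y); rewrite mul1r addrC subrK. Qed.

Lemma eqmod_nat (m i j : nat) : i = j %[mod m] -> eqmod (m%:R : A) i%:R j%:R.
Proof.
move=> ij; rewrite (divn_eq i m) (divn_eq j m) ij !natrD !natrM; apply: eqmodD.
  by exists ((i %/ m)%:R - (j %/ m)%:R); rewrite [_ * (_ - _)]mulrC mulrBl addrC subrK.
exact: eqmod_refl.
Qed.

(** The cofactor of [x - y] in [x ^+ p - y ^+ p] is a sum of [p] terms, each congruent to
    [y ^+ p.-1] modulo [p], hence divisible by [p]. *)
Lemma eqmod_frob (p k : nat) x y : (0 < k)%N -> eqmod (p ^ k)%:R x y ->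
  eqmod (p ^ k.+1)%:R (x ^+ p) (y ^+ p).
Proof.
move=> k0 xy; apply: (eqmodB0 _ _ _).2; rewrite subrXX expnSr natrM.
set c := \sum_(i < p) _.
suff c0 : eqmod p%:R c 0.
  rewrite -(mulr0 (x - y)); apply: eqmod_mul0 c0; exact: (eqmodB0 _ _ _).1 xy.
apply: (@eqmod_trans _ _ (\sum_(i < p) y ^+ p.-1)); last first.
  by exists (y ^+ p.-1); rewrite sumr_const card_ord mulr_natl add0r.
apply: eqmod_sum => i _.
have ip : (i <= p.-1)%N by rewrite -ltnS prednK // (leq_ltn_trans _ (ltn_ord i)).
rewrite -[in X in eqmod _ _ X](subnK ip) exprD.
have xyp : eqmod p%:R x y by move: xy; rewrite -[in p%:R](expn1 p); apply: eqmod_expn.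
by apply: eqmodMr; apply: eqmodX.
Qed.

Lemma eqmod_frobX (p k : nat) x y : eqmod p%:R x y ->
  eqmod (p ^ k.+1)%:R (x ^+ (p ^ k)) (y ^+ (p ^ k)).
Proof.
move=> xy; elim: k => [|k IH]; first by rewrite expn1 !expr1.
by rewrite [in X in _ ^+ X]expnSr [in X in eqmod _ _ (_ ^+ X)]expnSr !exprM; apply: eqmod_frob.
Qed.

End Eqmod.

(** * Frobenius congruences modulo a prime *)

Section PrimeFrobenius.
Variables (A : comPzRingType) (p : nat).
Hypothesis p_pr : prime p.
Implicit Types x y : A.

Lemma eqmod_exprDp x y : eqmod p%:R ((x + y) ^+ p) (x ^+ p + y ^+ p).
Proof.
rewrite exprDn; case: p p_pr => // n n_pr.
rewrite big_ord_recl big_ord_recr /= subn0 subnn !expr0 bin0 binn mulr1 mul1r !mulr1n.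
apply: eqmodD; first exact: eqmod_refl.
rewrite -[X in eqmod _ _ X]add0r; apply: eqmodD; last exact: eqmod_refl.
elim/big_ind: _ => [|a b a0 b0|i _]; first exact: eqmod_refl.
  by rewrite -(addr0 0); apply: eqmodD.
have /dvdnP[c ->] : (n.+1 %| 'C(n.+1, bump 0 i))%N.
  by apply: prime_dvd_bin => //; rewrite /bump leq0n add1n ltnS; apply: ltn_ord.
by rewrite mulrnA; eexists; rewrite add0r mulr_natl.
Qed.

(** Additivity of the [p]-th power is applied to [x] and [- x], which treats [p = 2] together with
    the odd primes. *)
Lemma eqmod_exprNp x : eqmod p%:R ((- x) ^+ p) (- x ^+ p).
Proof.
have := eqmod_exprDp x (- x); rewrite subrr expr0n eqn0Ngt prime_gt0 //= => E.
have {}E := eqmodD (eqmod_refl _ (- x ^+ p)) E.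
by apply/eqmod_sym; move: E; rewrite addr0 addKr.
Qed.

Lemma eqmod_exprzp (z : int) : eqmod p%:R (z%:~R ^+ p : A) z%:~R.
Proof.
elim/int_rect: z => [|n IH|n IH].
- by rewrite expr0n eqn0Ngt prime_gt0 //; apply: eqmod_refl.
- rewrite -addn1 PoszD rmorphD; apply: eqmod_trans (eqmod_exprDp _ _) _.
  by apply: eqmodD => //; rewrite expr1n; apply: eqmod_refl.
rewrite -addn1 PoszD opprD rmorphD; apply: eqmod_trans (eqmod_exprDp _ _) _.
apply: eqmodD => //; rewrite rmorphN; apply: eqmod_trans (eqmod_exprNp _) _.
by rewrite expr1n; apply: eqmod_refl.
Qed.

End PrimeFrobenius.

Lemma eqmod_rmorph (A B : comPzRingType) (f : {rmorphism A -> B}) m x y :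
  eqmod m x y -> eqmod (f m) (f x) (f y).
Proof. by case=> q ->; exists (f q); rewrite rmorphD rmorphM. Qed.

(** * Expansion of the powers of an element along a Frobenius lift *)

Section Expansion.
Variables (A : comPzRingType) (p : nat) (sigma : {rmorphism A -> A}) (La : A).
(** [S k] will be the polynomials of degree less than [p ^ k] in every variable. *)
Variable (S : nat -> A -> Prop).
Hypothesis p_gt0 : (0 < p)%N.
Hypothesis sigmaLa : eqmod p%:R (sigma La) (La ^+ p).
Hypothesis SB : forall k x y, S k x -> S k y -> S k (x - y).
Hypothesis SLa : forall k n, (n < p ^ k)%N -> S k (La ^+ n).
Hypothesis SM : forall k l x y, S k x -> S l y -> S (k + l) (x * iter k sigma y).

Lemma iter_rmorphM k x y : iter k sigma (x * y) = iter k sigma x * iter k sigma y.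
Proof. by elim: k => //= k ->; rewrite rmorphM. Qed.

Lemma iter_rmorph_nat k n : iter k sigma n%:R = n%:R.
Proof. by elim: k => //= k ->; rewrite rmorph_nat. Qed.

Lemma eqmod_iter k n x y : eqmod n%:R x y ->
  eqmod n%:R (iter k sigma x) (iter k sigma y).
Proof.
by move=> xy; elim: k => //= k /(eqmod_rmorph sigma); rewrite rmorph_nat.
Qed.

(** One factor [p] of the exponent is traded for one [sigma] at a time: [sigma La] and [La ^+ p]
    agree modulo [p], so their powers of exponent [p ^ k] agree modulo [p ^ k.+1]. *)
Lemma eqmod_frob_iter j k m :
  eqmod (p ^ k.+1)%:R (La ^+ (p ^ (k + j) * m)) (iter j sigma (La ^+ (p ^ k * m))).
Proof.
elim: j k => [|j IH] k; first by rewrite addn0; apply: eqmod_refl.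
apply: (@eqmod_trans _ _ _ (iter j sigma (La ^+ (p ^ k.+1 * m)))).
  by rewrite addnS -addSn; apply: eqmod_expn (IH k.+1).
rewrite iterSr; apply: eqmod_iter; rewrite rmorphXn !exprM; apply: eqmodX.
by rewrite [in X in _ ^+ X]expnS exprM; apply: eqmod_frobX; apply: eqmod_sym.
Qed.

Let filtr0 k : S k 0.
Proof. by rewrite -(subrr (La ^+ 0)); apply: SB; apply: SLa; rewrite expn_gt0 p_gt0. Qed.

Let filtrD k x y : S k x -> S k y -> S k (x + y).
Proof.
by move=> Sx Sy; rewrite -[y]opprK -[- y]sub0r; do 2 apply: SB => //; apply: filtr0.
Qed.

(* The terms are built one at a time: the next one is the defect of the previous
   expansion at the exponent [M %% p ^ s.+1], hence divisible by [p ^ s]. *)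
Lemma Dwork_expansion M s : exists c : nat -> A,
  [/\ forall j, (j < s)%N -> eqmod (p ^ j)%:R (c j) 0,
      forall j, (j < s)%N -> S j.+1 (c j) &
      forall L, L = M %[mod p ^ s] -> eqmod (p ^ s)%:R (La ^+ L)
        (\sum_(j < s) c j * iter j.+1 sigma (La ^+ (L %/ p ^ j.+1)))].
Proof.
have pX k : (0 < p ^ k)%N by rewrite expn_gt0 p_gt0.
elim: s => [|s [c [c0 cS cE]]].
  by exists (fun=> 0); split=> // L _; apply: eqmod_exp0.
pose M' := (M %% p ^ s.+1)%N.
pose e := La ^+ M' -
  \sum_(j < s) c j * iter j.+1 sigma (La ^+ (M' %/ p ^ j.+1)).
have M'M : M' = M %[mod p ^ s] by rewrite /M' modn_dvdm // expnS dvdn_mull.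
have e0 : eqmod (p ^ s)%:R e 0 by apply: (eqmodB0 _ _ _).1; apply: cE.
have eS : S s.+1 e.
  apply: SB; first by apply: SLa; rewrite ltn_mod.
  apply: (big_ind (S s.+1)) => [||j _]; [exact: filtr0|exact: filtrD|].
  (* As [M' < p ^ s.+1], the exponent [M' %/ p ^ j.+1] is less than [p ^ (s - j)]: the filtration
     degrees [j.+1] and [s - j] of the two factors add up to [s.+1]. *)
  have -> : s.+1 = (j.+1 + (s - j))%N by rewrite addSn subnKC // ltnW.
  apply: SM; first exact: cS.
  by apply: SLa; rewrite ltn_divLR // -expnD addnS subnK ?ltn_mod // ltnW.
exists (fun j => if j == s then e else c j); split.
- move=> j; rewrite ltnS leq_eqVlt; case: eqP => [-> _|_ /=]; first exact: e0.
  exact: c0.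
- move=> j; rewrite ltnS leq_eqVlt; case: eqP => [-> _|_ /=]; first exact: eS.
  exact: cS.
move=> L LM; pose c' j := if j == s then e else c j.
have c'0 (j : 'I_s.+1) : eqmod (p ^ j)%:R (c' j) 0.
  rewrite /c'; case: eqP => [->//|/eqP]; move: (ltn_ord j).
  by rewrite ltnS leq_eqVlt => /orP[/eqP->|js _]; [rewrite eqxx|apply: c0].
(* At [M'] the lengthened expansion is an equality: [M' < p ^ s.+1], so the power of [La] in the
   last term is [1]. *)
have E : La ^+ M' = \sum_(j < s.+1) c' j * iter j.+1 sigma (La ^+ (M' %/ p ^ j.+1)).
  rewrite big_ord_recr /= {2}/c' eqxx divn_small ?ltn_mod // expr0.
  rewrite -iterS (iter_rmorph_nat s.+1 1) mulr1.
  rewrite (eq_bigr (fun j : 'I_s => c j * iter j.+1 sigma (La ^+ (M' %/ p ^ j.+1)))).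
    by rewrite addrC subrK.
  by move=> j _; rewrite /c' ltn_eqF.
pose m := (L %/ p ^ s.+1)%N.
have LE : L = (M' + p ^ s.+1 * m)%N by rewrite addnC mulnC /M' -LM -divn_eq.
(* The equality is multiplied by [La ^+ (p ^ s.+1 * m)]. In the [j]-th term this factor passes under
   [j.+1] iterates of [sigma] modulo [p ^ (s - j).+1], and [c' j] supplies the missing [p ^ j]. *)
rewrite [in X in eqmod _ X]LE exprD E mulr_suml; apply: eqmod_sum => j _.
have js : (j <= s)%N by rewrite -ltnS.
have -> : (L %/ p ^ j.+1 = M' %/ p ^ j.+1 + p ^ (s - j) * m)%N.
  have -> : L = (p ^ (s - j) * m * p ^ j.+1 + M')%N.
    by rewrite LE mulnAC -expnD addnS subnK // addnC.
  by rewrite divnMDl // addnC.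
rewrite exprD iter_rmorphM -mulrA.
have -> : (p ^ s.+1)%:R = (p ^ j)%:R * (p ^ (s - j).+1)%:R :> A.
  by rewrite -natrM -expnD addnS subnKC.
apply: eqmod_mul0; first exact: c'0.
apply: eqmodMl; have := eqmod_frob_iter j.+1 (s - j) m.
by rewrite addnS subnK.
Qed.

End Expansion.

(** * Formal power series *)

Section Series.
Variable A : comNzRingType.
Implicit Types (f g u : pseries A) (c : nat).

Lemma psD f g i : (f + g) i = f i + g i. Proof. by []. Qed.

Lemma psMn f c i : (f *+ c) i = f i *+ c.
Proof. by elim: c => // c IH; rewrite !mulrS psD IH. Qed.

Lemma psM f g n : (f * g) n = \sum_(i < n.+1) f i * g (n - i)%N.
Proof. by []. Qed.

Lemma ps1E i : (1 : pseries A) i = (i == 0)%:R.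
Proof. exact: coef1. Qed.

Lemma eqmod_psP c f g :
  eqmod c%:R f g <-> forall i, eqmod (c%:R : A) (f i) (g i).
Proof.
split=> [[q ->] i|fg]; first by exists (q i); rewrite psD !mulr_natl psMn.
have /choice[q qE] : forall i, exists q, f i = g i + c%:R * q by [].
exists (q : pseries A); apply/funext => i.
by rewrite psD mulr_natl psMn -mulr_natl.
Qed.

Lemma of_poly_is_zmod : zmod_morphism (@of_poly A).
Proof. by move=> f g; apply/funext => i; apply: coefB. Qed.

Lemma of_poly_is_monoid : monoid_morphism (@of_poly A).
Proof. by split=> // f g; apply/funext => i; rewrite /of_poly coefM psM. Qed.

HB.instance Definition _ :=
  GRing.isZmodMorphism.Build {poly A} (pseries A) (@of_poly A) of_poly_is_zmod.
HB.instance Definition _ :=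
  GRing.isMonoidMorphism.Build {poly A} (pseries A) (@of_poly A) of_poly_is_monoid.

Lemma eqmod_polyP c (f g : {poly A}) :
  eqmod c%:R f g <-> forall i, eqmod (c%:R : A) f`_i g`_i.
Proof.
split=> [[q ->] i|fg]; first by exists q`_i; rewrite coefD !mulr_natl coefMn.
have /choice[q qE] : forall i, exists q, f`_i = g`_i + c%:R * q by [].
(* The quotients chosen beyond both sizes are arbitrary and have to be cut off. *)
exists (\poly_(i < maxn (size f) (size g)) q i); apply/polyP => i.
rewrite coefD mulr_natl coefMn coef_poly; case: ltnP => [_|].
  by rewrite -mulr_natl.
by rewrite geq_max => /andP[fi gi]; rewrite !nth_default // mul0rn addr0.
Qed.

Lemma eqmod_of_poly c (f g : {poly A}) :
  eqmod c%:R (of_poly f) (of_poly g) <-> eqmod c%:R f g.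
Proof. by split=> [/eqmod_psP fg|fg]; [apply/eqmod_polyP|apply/eqmod_psP/eqmod_polyP]. Qed.

Lemma psX_small u k i : u 0%N = 0 -> (i < k)%N -> (u ^+ k) i = 0.
Proof.
move=> u0; elim: k i => // k IH i ik; rewrite exprS psM big1 // => -[[|j] ji] _ /=.
  by rewrite u0 mul0r.
by rewrite IH ?mulr0 //; move: ji ik; rewrite !ltnS; case: i => // i _ ik;
   rewrite subSS (leq_ltn_trans (leq_subr _ _)).
Qed.

(* The inverse of [f = 1 - u] is the geometric series in [u]. *)
Lemma ps_unit f : f 0%N = 1 -> f \is a GRing.unit.
Proof.
move=> f0; pose u : pseries A := 1 - f.
have u0 : u 0%N = 0 by rewrite /u psD ps1E -[X in _ + X]/(- f 0%N) f0 subrr.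
have E k n i : (i < n)%N -> (i < k)%N ->
    (\sum_(j < n) u ^+ j) i = (\sum_(j < k) u ^+ j) i.
  wlog nk : k n / (n <= k)%N => [wl|] i_n i_k.
    by case: (leqP n k) => [/wl|/ltnW/wl /(_ i_k i_n)]; auto.
  rewrite -(subnK nk) addnC big_split_ord /= psD [X in _ = _ + X](_ : _ = 0) ?addr0 //.
  apply: (big_ind (fun g : pseries A => g i = 0)) => // [g h|j _].
    by rewrite psD => -> ->; rewrite addr0.
  by apply: psX_small => //; apply: ltn_addr.
pose g : pseries A := fun n => (\sum_(j < n.+1) u ^+ j) n.
apply/asboolP; exists g; rewrite mulrC; apply/funext => n.
transitivity ((f * \sum_(j < n.+1) u ^+ j) n).
  by rewrite !psM; apply: eq_bigr => i _; congr (_ * _); apply: E; rewrite // ltnS leq_subr.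
have -> : f = 1 - u by rewrite /u subKr.
rewrite -opprB mulNr -subrX1 opprB psD -[X in _ + X]/(- (u ^+ n.+1) n).
by rewrite psX_small // subr0.
Qed.

Lemma eqmod_cancel c u f g : u 0%N = 1 ->
  eqmod c%:R (u * f) (u * g) -> eqmod c%:R f g.
Proof. by move=> /ps_unit uU /(eqmodMl u^-1); rewrite !mulKr. Qed.

Lemma eqmod_poly_cancel c (u f g : {poly A}) : u`_0 = 1 ->
  eqmod c%:R (u * f) (u * g) -> eqmod c%:R f g.
Proof.
move=> u0 /(eqmod_rmorph (@of_poly A)); rewrite !rmorphM rmorph_nat.
by move=> /(@eqmod_cancel c (of_poly u)) => /(_ u0)/eqmod_of_poly.
Qed.

(** As [g] has degree less than [q], only the Euclidean division of [K] by [q] contributes to the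
    convolution. *)
Lemma coef_mul_comp_Xn q (f g : {poly A}) K : (0 < q)%N -> (size g <= q)%N ->
  (g * (f \Po 'X^q))`_K = g`_(K %% q) * f`_(K %/ q).
Proof.
move=> q0 gq; rewrite coefM.
have KK : (K %% q < K.+1)%N by rewrite ltnS leq_mod.
have E : (K - K %% q = K %/ q * q)%N by rewrite {1}(divn_eq K q) addnK.
rewrite (bigD1 (Ordinal KK)) //= big1 => [|i].
  by rewrite addr0 coef_comp_poly_Xn // E dvdn_mull // mulnK.
rewrite -val_eqE /= => iK; rewrite coef_comp_poly_Xn //.
case: (ltnP i q) => [iq|/(leq_trans gq) gi]; last by rewrite nth_default ?mul0r.
rewrite ifN ?mulr0 //; apply: contra iK => qK.
have iK' : (i <= K)%N by rewrite -ltnS.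
by apply/eqP; rewrite -[in RHS](subnK iK') -modnDml (eqP qK) add0n modn_small.
Qed.

End Series.

(** * Dwork congruences for the truncated parameters *)

(* The hypergeometric series with all parameters equal to [- L]. *)
Definition hypoly (r L : nat) : {poly int} :=
  \poly_(k < L.+1) ((-1) ^+ k * 'C(L, k)%:R) ^+ r.

Lemma coef_hypoly r L k :
  (hypoly r.+1 L)`_k = ((-1) ^+ k * 'C(L, k)%:R) ^+ r.+1.
Proof.
by rewrite coef_poly; case: ltnP => // Lk; rewrite bin_small // mulr0 expr0n.
Qed.

(** * Diagonals of polynomials in several variables *)

Section Diagonal.
Variables (d p : nat).
Hypothesis p_pr : prime p.
Local Notation A := {mpoly int[d.+1]}.
Local Notation P := (hypoly d.+1).

Let La : A := \prod_(i < d.+1) (1 - 'X_i).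
Local Notation lift_frob :=
  (comp_mpoly [tuple ('X_i : A) ^+ p | i < d.+1] : A -> A).

Let frobE k (f : A) :
  iter k lift_frob f = \sum_(m <- msupp f) f@_m *: 'X_[m *+ p ^ k].
Proof.
elim: k => [|k IH]; first by rewrite /= {1}[f]mpolyE; apply: eq_bigr => m _; rewrite mulm1n.
rewrite iterS IH raddf_sum; apply: eq_bigr => m _; rewrite /= comp_mpolyZ.
rewrite comp_mpolyX; congr (_ *: _); rewrite [RHS]mpolyXE_id.
apply: eq_bigr => i _; rewrite tnth_mktuple !mulmnE -exprM.
by rewrite expnS mulnCA.
Qed.

Let mul_frobE k (f g : A) : f * iter k lift_frob g =
  \sum_(m <- msupp f) \sum_(m' <- msupp g) (f@_m * g@_m') *: 'X_[m + m' *+ p ^ k].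
Proof.
rewrite frobE {1}[f]mpolyE big_distrl; apply: eq_bigr => m _.
rewrite big_distrr; apply: eq_bigr => m' _ /=.
by rewrite -scalerAl -scalerAr scalerA mpolyXD.
Qed.

(** The variables separate: [La ^+ n] is the product of the binomial expansions of the
    [(1 - 'X_i) ^+ n]. *)
Let mcoeff_La n m : (La ^+ n)@_m = \prod_i ((-1) ^+ m i * 'C(n, m i)%:R).
Proof.
have -> : La ^+ n = \sum_(f : {ffun 'I_d.+1 -> 'I_n.+1})
    (\prod_i ((-1) ^+ f i * 'C(n, f i)%:R)) *: 'X_[[multinom (f i : nat) | i < d.+1]].
  rewrite /La -prodrXl.
  under eq_bigr => i _ do rewrite exprBn.
  rewrite bigA_distr_bigA; apply: eq_bigr => f _.
  rewrite mpolyXE_id -scaler_prod; apply: eq_bigr => i _.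
  rewrite mnmE expr1n mulr1 [in RHS]mulrC -scalerA scaler_nat; congr (_ *+ _).
  by rewrite -signr_odd -[in RHS]signr_odd scaler_sign mulr_sign.
rewrite raddf_sum /=; case: (boolP [forall i, m i < n.+1]%N) => [/forallP mn|].
  pose f0 : {ffun 'I_d.+1 -> 'I_n.+1} := [ffun i => Ordinal (mn i)].
  have f0E i : f0 i = m i :> nat by rewrite ffunE.
  rewrite (bigD1 f0) //= [X in _ + X]big1 ?addr0 => [|f ff0]; rewrite mcoeffZ mcoeffX.
    rewrite (_ : _ == m) ?mulr1; first by apply: eq_bigr => i _; rewrite f0E.
    by apply/eqP/mnmP => i; rewrite mnmE f0E.
  rewrite (_ : _ == m = false) ?mulr0 //; apply: contraNF ff0 => /eqP fm.
  by apply/eqP/ffunP => i; apply/val_inj; rewrite /= f0E -fm mnmE.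
rewrite negb_forall => /existsP[i ni]; rewrite (bigD1 i) //= bin_small; last first.
  by rewrite ltnNge -ltnS.
rewrite mulr0 mul0r big1 // => f _; rewrite mcoeffZ mcoeffX.
rewrite (_ : _ == m = false) ?mulr0 //; apply: contraNF ni => /eqP <-.
by rewrite mnmE.
Qed.

Let bounded k (f : A) := forall m, m \in msupp f -> forall i, (m i < p ^ k)%N.

Let boundedB k f g : bounded k f -> bounded k g -> bounded k (f - g).
Proof.
by move=> fk gk m /msuppB_le; rewrite mem_cat => /orP[/fk|/gk].
Qed.

Let boundedX n k : (n < p ^ k)%N -> bounded k (La ^+ n).
Proof.
move=> nk m; rewrite mcoeff_msupp mcoeff_La => + i; apply: contraR.
rewrite -leqNgt => mi; rewrite (bigD1 i) //= bin_small ?mulr0 ?mul0r //.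
exact: leq_trans nk mi.
Qed.

Let boundedM k l f g : bounded k f -> bounded l g ->
  bounded (k + l) (f * iter k lift_frob g).
Proof.
move=> fk gl; rewrite mul_frobE.
have b0 : bounded (k + l) 0 by move=> m; rewrite msupp0.
have bD x y : bounded (k + l) x -> bounded (k + l) y -> bounded (k + l) (x + y).
  by move=> xb yb m /msuppD_le; rewrite mem_cat => /orP[/xb|/yb].
rewrite big_seq; apply: big_ind => // m mf.
rewrite big_seq; apply: big_ind => // m' mg m''.
move=> /msuppZ_le; rewrite msuppX mem_seq1 => /eqP -> i.
rewrite mnmDE mulmnE expnD; have := fk _ mf i; have := gl _ mg i.
set q := (p ^ k)%N; set q' := (p ^ l)%N => m'q mq.
by rewrite (leq_trans (n := (q + m' i * q)%N)) ?ltn_add2r // -mulSn mulnC leq_mul2l m'q orbT.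
Qed.

Let diag K : 'X_{1..d.+1} := [multinom K | _ < d.+1].
(** The bound [msize f] loses no diagonal coefficient, since [diag K] has total degree at least
    [K]. *)
Let phi (f : A) : {poly int} := \poly_(K < msize f) f@_(diag K).

Let coef_phi f K : (phi f)`_K = f@_(diag K).
Proof.
rewrite coef_poly; case: ltnP => // fK; apply/esym/memN_msupp_eq0/msize_mdeg_ge.
apply: leq_trans fK _; rewrite mdegE (bigD1 ord0) //= mnmE; exact: leq_addr.
Qed.

(** If [m + m' *+ p ^ k] is the diagonal monomial of exponent [K] and all [m i < p ^ k], then by
    uniqueness of Euclidean division every [m i] is [K %% p ^ k] and every [m' i] is [K %/ p ^ k]:
    both monomials are diagonal. *)
Let phi_frobM k f g : bounded k f ->
  phi (f * iter k lift_frob g) = phi f * (phi g \Po 'X^(p ^ k)).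
Proof.
move=> fk; have q0 : (0 < p ^ k)%N by rewrite expn_gt0 prime_gt0.
apply/polyP => K; rewrite coef_mul_comp_Xn //; last first.
  apply/leq_sizeP => j kj; rewrite coef_phi; apply: memN_msupp_eq0.
  by apply/negP => /fk/(_ ord0); rewrite mnmE ltnNge kj.
rewrite !coef_phi mul_frobE [in RHS](mpolyE f) [in RHS](mpolyE g) !raddf_sum /=.
rewrite big_distrl [LHS]big_seq [RHS]big_seq; apply: eq_bigr => m mf.
rewrite raddf_sum big_distrr /=; apply: eq_bigr => m' _.
rewrite !mcoeffZ !mcoeffX mulrACA -natrM mulnb; congr (_ * (nat_of_bool _)%:R).
apply/eqP/andP => [/mnmP E|[/eqP -> /eqP ->]].
  have {}E i : (m' i * p ^ k + m i)%N = K.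
    by have := E i; rewrite mnmDE mulmnE !mnmE addnC.
  by split; apply/eqP/mnmP => i; rewrite mnmE -(E i);
    [rewrite modnMDl modn_small ?fk|rewrite divnMDl ?divn_small ?addn0 ?fk].
by apply/mnmP => i; rewrite mnmDE mulmnE !mnmE addnC -divn_eq.
Qed.

Let phi_La L : phi (La ^+ L) = P L.
Proof.
apply/polyP => K; rewrite coef_phi mcoeff_La coef_hypoly.
under eq_bigr => i _ do rewrite mnmE.
by rewrite prodr_const card_ord.
Qed.

Let eqmod_phi c f g : eqmod c%:R f g -> eqmod c%:R (phi f) (phi g).
Proof.
case=> q ->; exists (phi q); apply/polyP => K.
by rewrite coefD !mulr_natl coefMn !coef_phi raddfD raddfMn.
Qed.

Let phi0 : phi 0 = 0.
Proof. by apply/polyP => K; rewrite coef_phi mcoeff0 coef0. Qed.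

Lemma hypoly_expansion M s : exists c : nat -> {poly int},
  (forall j, (j < s)%N -> eqmod (p ^ j)%:R (c j) 0) /\
  forall L, L = M %[mod p ^ s] -> eqmod (p ^ s)%:R (P L)
    (\sum_(j < s) c j * (P (L %/ p ^ j.+1) \Po 'X^(p ^ j.+1))).
Proof.
have p0 := prime_gt0 p_pr.
have [] := @Dwork_expansion A p lift_frob La bounded p0 _ boundedB
  (fun k n => @boundedX n k) boundedM M s.
  (* Factor by factor, [(1 - 'X_i) ^+ p] is congruent to [1 - 'X_i ^+ p] modulo [p]. *)
  rewrite /La rmorph_prod -prodrXl; elim/big_rec2: _ => [|i x y _ xy].
    exact: eqmod_refl.
  apply: eqmodM => //; apply: eqmod_sym; rewrite rmorphB rmorph1 /=.
  rewrite comp_mpolyXU -tnth_nth tnth_mktuple.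
  apply: eqmod_trans (eqmod_exprDp p_pr _ _) _; rewrite expr1n.
  by apply: eqmodD; [apply: eqmod_refl|apply: eqmod_exprNp].
move=> c [c0 cb cE]; exists (phi \o c); split=> [j /c0/eqmod_phi|L LM].
  by rewrite phi0.
rewrite -phi_La; apply: eqmod_trans (eqmod_phi (cE L LM)) _.
suff -> : phi (\sum_(j < s) c j * iter j.+1 lift_frob (La ^+ (L %/ p ^ j.+1))) =
  \sum_(j < s) (phi \o c) j * (P (L %/ p ^ j.+1) \Po 'X^(p ^ j.+1)).
  exact: eqmod_refl.
apply/polyP => K; rewrite coef_phi raddf_sum coef_sum; apply: eq_bigr => j _.
by rewrite -phi_La -phi_frobM ?coef_phi //; apply: cb.
Qed.

Lemma hypoly_at0 L : (P L)`_0 = 1.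
Proof. by rewrite coef_hypoly expr0 mul1r bin0 expr1n. Qed.

(** Induction on [s]. [P L] and [P M] have expansions with the same [c], so the [j]-th terms can be
    compared one by one; as [p ^ j] divides [c j], only the precision [s - j] is left to prove. *)
Theorem hypoly_congruence s L M : L = M %[mod p ^ s] ->
  eqmod (p ^ s)%:R (P L * (P (M %/ p) \Po 'X^p)) (P M * (P (L %/ p) \Po 'X^p)).
Proof.
elim/ltn_ind: s L M => s IH L M LM; have p0 := prime_gt0 p_pr.
pose X (n j : nat) := P (n %/ p ^ j) \Po 'X^(p ^ j).
have X_at0 n j : (X n j)`_0 = 1.
  by rewrite coef_comp_poly_Xn ?expn_gt0 ?p0 // dvdn0 div0n hypoly_at0.
have XS n j : X n j.+1 = (P (n %/ p ^ j %/ p) \Po 'X^p) \Po 'X^(p ^ j).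
  rewrite /X -comp_polyA comp_Xn_poly -exprM -expnSr.
  by rewrite -divnMA -expnSr.
(* The induction hypothesis at [s - j], with the variable raised to the power [p ^ j]; [0 < j] makes
   this precision smaller than [s]. *)
have step j : (0 < j <= s)%N ->
    eqmod (p ^ (s - j))%:R (X L j * X M j.+1) (X M j * X L j.+1).
  case/andP=> j0 js; have sj : (s - j < s)%N by rewrite ltn_subrL j0 (leq_trans j0 js).
  rewrite !XS -!comp_polyM.
  have LMj : L %/ p ^ j = M %/ p ^ j %[mod p ^ (s - j)].
    by rewrite !modn_divl -expnD subnK // LM.
  have := eqmod_rmorph (comp_poly 'X^(p ^ j)) (IH _ sj _ _ LMj).
  by rewrite rmorph_nat.
(* The quotients of [X L j] by [X M j] are linked by [step] down to [j = 1]; the intermediate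
   factors cancel because their constant term is [1]. *)
have chain j : (j < s)%N ->
    eqmod (p ^ (s - j))%:R (X L j.+1 * X M 1) (X M j.+1 * X L 1).
  elim: j => [_|j IHj js]; first by rewrite mulrC; apply: eqmod_refl.
  apply: (eqmod_poly_cancel (X_at0 M j.+1)).
  have E1 := eqmod_expn (leq_sub2l s (leqnSn j)) (IHj (ltnW js)).
  have E2 := step j.+1 (ltnW js).
  rewrite mulrA; apply: eqmod_trans (eqmodMr _ (eqmod_sym E2)) _.
  by rewrite [in X in eqmod _ _ X]mulrCA mulrAC [in X in eqmod _ _ X]mulrC; apply: eqmodMr.
have [c [c0 cE]] := hypoly_expansion M s.
have E n : n = M %[mod p ^ s] -> eqmod (p ^ s)%:R (P n) (\sum_(j < s) c j * X n j.+1).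
  exact: cE.
have X1 n : P (n %/ p) \Po 'X^p = X n 1 by rewrite /X expn1.
rewrite !X1; apply: eqmod_trans (eqmodMr _ (E L LM)) _.
apply: eqmod_trans (eqmod_sym (eqmodMr _ (E M (erefl _)))).
rewrite !mulr_suml; apply: eqmod_sum => j _; rewrite -!mulrA.
have js : (j <= s)%N by apply/ltnW/ltn_ord.
rewrite -[in (p ^ s)%N](subnKC js) expnD natrM.
by apply: eqmod_mul0; [exact: c0|exact: chain].
Qed.

End Diagonal.

(** * The p-adic integers *)

Lemma ideal1P (A : comPzRingType) (a x : A) :
  x \in ideal [:: a] <-> exists c, x = c * a.
Proof.
split=> [/asboolP[c ->]|[c ->]]; first by exists (c 0%N); rewrite big_ord1.
by apply/asboolP; exists (fun=> c); rewrite big_ord1.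
Qed.

Lemma ideal2P (A : comPzRingType) (a b x : A) :
  x \in ideal [:: a; b] <-> exists c e, x = c * a + e * b.
Proof.
split=> [/asboolP[c ->]|[c [e ->]]].
  by exists (c 0%N), (c 1%N); rewrite big_ord_recl big_ord1.
by apply/asboolP; exists (fun i => if i == 0%N then c else e); rewrite big_ord_recl big_ord1.
Qed.

Lemma ideal2l (A : comPzRingType) (a b : A) : a \in ideal [:: a; b].
Proof. by apply/ideal2P; exists 1, 0; rewrite mul1r mul0r addr0. Qed.

Lemma ideal2r (A : comPzRingType) (a b : A) : b \in ideal [:: a; b].
Proof. by apply/ideal2P; exists 0, 1; rewrite mul1r mul0r add0r. Qed.

Lemma to_q_eq0 (A : comPzRingType) (s : seq A) x : to_q s x = 0 <-> x \in ideal s.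
Proof.
rewrite -[0](raddf0 (to_q s)).
by split=> [/to_q_eqP|xs]; [|apply/to_q_eqP]; rewrite subr0.
Qed.

Section InverseLimit.
Variables (A : comPzRingType) (s : nat -> seq A).
Hypothesis s_decr : forall n x, x \in ideal (s n.+1) -> x \in ideal (s n).
Implicit Types x y : ilim s.

Lemma proj_leq x n m g : (n <= m)%N -> x m = to_q _ g -> x n = to_q _ g.
Proof.
elim: m g => [|m IH] g; first by rewrite leqn0 => /eqP ->.
rewrite leq_eqVlt => /orP[/eqP->//|nm] xg; apply: IH => //.
have /asboolP/(_ m)[g' [xg' ->]] := projP x.
by apply/esym/to_q_eqP/s_decr/to_q_eqP; rewrite -xg xg'.
Qed.

Lemma ilim_reprs x : exists g : nat -> A, forall n, x n = to_q _ (g n).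
Proof.
have /choice[g gE] n : exists g, x n = to_q _ g.
  by have [g gE] := to_q_surj (x n); exists g.
by exists g.
Qed.

End InverseLimit.

Section Padic.
Variables (p : nat) (p_pr : prime p).
Local Notation Zp := (padic p_pr).
Local Notation s := (fun n => [:: (p ^ n)%:Z]).
Implicit Types x y z : Zp.

Let p_gt0 : (0 < p)%N := prime_gt0 p_pr.
Let pX_neq0 n : (p ^ n)%:Z != 0 :> int.
Proof. by rewrite eqz_nat expn_eq0 negb_and -lt0n p_gt0. Qed.

Lemma padic_decr n (x : int) : x \in ideal (s n.+1) -> x \in ideal (s n).
Proof. by move=> /ideal1P[c ->]; apply/ideal1P; exists (c * p); rewrite expnS PoszM mulrA. Qed.

Lemma proj_int (c : int) n : proj (c%:~R : Zp) n = to_q _ c.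
Proof.
have -> : c%:~R = to_lim s c :> Zp; last by [].
by rewrite -[c in RHS]intz rmorph_int.
Qed.

Lemma proj_nat (c : nat) n : proj (c%:R : Zp) n = to_q _ c%:Z.
Proof. by rewrite pmulrn proj_int. Qed.

(** Conversely, if [x - y] vanishes at level [n], its representatives at the levels [m + n] are
    divisible by [p ^ n], and the quotients form a coherent sequence. *)
Lemma padic_eqmodP n x y : eqmod (p ^ n)%:R x y <-> proj x n = proj y n.
Proof.
split=> [[q ->]|].
  rewrite -[LHS]/(proj y n + proj (p ^ n)%:R n * proj q n) proj_nat.
  rewrite (to_q_eq0 _ (p ^ n)%:Z).2 ?mul0r ?addr0 //.
  by apply/ideal1P; exists 1; rewrite mul1r.
move=> xy; apply: (eqmodB0 _ _ _).2; set z := x - y.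
have z0 : proj z n = 0 by rewrite -[LHS]/(proj x n - proj y n) xy subrr.
have [g gE] := ilim_reprs z.
have gle i j : (i <= j)%N -> proj z i = to_q _ (g j).
  by move=> ij; apply: (proj_leq padic_decr ij).
have /choice[q qE] m : exists q, g (m + n)%N = q * (p ^ n)%:Z.
  by apply/ideal1P/to_q_eq0; rewrite -gle ?leq_addl.
have coh_q : `[< coherent (fun m => to_q (s m) (q m)) >].
  apply/asboolP => m; exists (q m.+1); split=> //; apply/to_q_eqP/ideal1P.
  have /ideal1P[c cE] : g (m + n)%N - g (m.+1 + n)%N \in ideal (s (m + n)).
    by apply/to_q_eqP; rewrite -!gle // leq_add2r.
  exists c; apply/(mulIf (pX_neq0 n)); rewrite mulrBl -!qE cE expnD PoszM.
  by rewrite mulrA.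
exists (Ilim coh_q : Zp); rewrite add0r; apply: ilimP => m.
rewrite -[RHS]/(proj (p ^ n)%:R m * to_q _ (q m)) proj_nat -rmorphM mulrC -qE.
by apply: gle; apply: leq_addr.
Qed.

(** The approximations are opposites of natural numbers because the hypergeometric series with
    parameters [- L] is the polynomial [hypoly]. *)
Lemma padic_approx x n : exists2 L, (L < p ^ n)%N & eqmod (p ^ n)%:R x (- L%:R).
Proof.
have [g gE] := ilim_reprs x.
have r0 : (0 <= (- g n %% (p ^ n)%:Z)%Z)%R by rewrite modz_ge0.
exists `|(- g n %% (p ^ n)%:Z)%Z|%N.
  by rewrite -ltz_nat gez0_abs // ltz_pmod // lt0r pX_neq0.
apply/padic_eqmodP; rewrite pmulrn -rmorphN proj_int gez0_abs // gE.
apply/to_q_eqP/ideal1P; exists (- (- g n %/ (p ^ n)%:Z)%Z).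
by rewrite opprK mulNr /modz addrA subrr add0r.
Qed.

Lemma padic_int_eqmod n (i j : int) :
  eqmod (p ^ n)%:R (i%:~R : Zp) j%:~R <-> eqmod (p ^ n)%:R i j.
Proof.
split=> [/padic_eqmodP|]; last first.
  by move=> /(eqmod_rmorph (intmul 1 : {rmorphism int -> Zp})); rewrite rmorph_nat.
rewrite !proj_int => /to_q_eqP/ideal1P[c cE]; exists c.
by apply/eqP; rewrite addrC -subr_eq cE mulrC natz.
Qed.

Lemma padic_opp_nat_eqmod n (i j : nat) :
  eqmod (p ^ n)%:R (- i%:R : Zp) (- j%:R) <-> i = j %[mod p ^ n].
Proof.
split=> [/eqmodN|/(eqmod_nat Zp)/eqmodN //]; rewrite !opprK !pmulrn => /padic_int_eqmod.
case=> q E; apply/eqP; rewrite -eqz_nat -!modz_nat E addrC.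
by rewrite natz mulrC modzMDl.
Qed.

(** The inverses modulo the [p ^ m] come from Bezout's identity; they are coherent because [u] can
    be cancelled modulo [p ^ m]. *)
Lemma padic_coprime_unit u : coprime u p -> exists v : Zp, u%:R * v = 1.
Proof.
move=> up; have cop m : coprimez u (p ^ m)%:Z by rewrite coprimezE /= coprimeXr.
have /choice[v vE] m : exists v, exists w, u%:Z * v = 1 + w * (p ^ m)%:Z.
  have [[a b] /= E] := coprimezP _ _ (cop m); exists a, (- b).
  by rewrite mulrC -E mulNr addrK.
have coh_v : `[< coherent (fun m => to_q (s m) (v m)) >].
  apply/asboolP => m; exists (v m.+1); split=> //; apply/to_q_eqP/ideal1P.
  have [w wE] := vE m; have [w' w'E] := vE m.+1.
  have : ((p ^ m)%:Z %| u%:Z * (v m - v m.+1))%Z.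
    apply/dvdzP; exists (w - w' * p); rewrite mulrBr wE w'E expnS PoszM.
    by rewrite opprD addrACA subrr add0r mulrA mulrBl.
  rewrite Gauss_dvdzr; last by rewrite coprimez_sym.
  by move=> /dvdzP.
exists (Ilim coh_v : Zp); apply: ilimP => m.
rewrite -[LHS]/(proj u%:R m * to_q _ (v m)) proj_nat -rmorphM.
have [w ->] := vE m; rewrite -[RHS](proj_nat 1); apply/to_q_eqP/ideal1P.
by exists w; rewrite addrC addKr.
Qed.

End Padic.

(** * Division in the p-adic integers and approximation of hypergeometric coefficients *)

Section PadicDivision.
Variables (p : nat) (p_pr : prime p).
Local Notation Zp := (padic p_pr).
Implicit Types x y z : Zp.

Lemma padic_eq0 x : (forall n, eqmod (p ^ n)%:R x 0) -> x = 0.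
Proof. by move=> x0; apply: ilimP => n; apply/padic_eqmodP. Qed.

(** Replacing [x - y] by a sufficiently close [- L] turns this into a divisibility between natural
    numbers. *)
Lemma eqmod_padicX_cancel k n x y :
  eqmod (p ^ (k + n))%:R ((p ^ k)%:R * x) ((p ^ k)%:R * y) -> eqmod (p ^ n)%:R x y.
Proof.
move=> E; apply: (eqmodB0 _ _ _).2; have {E} := (eqmodB0 _ _ _).1 E.
rewrite -mulrBr; set z := x - y => E.
have [L _ zL] := padic_approx z (k + n).
have zLn : eqmod (p ^ n)%:R z (- L%:R) by apply: eqmod_expn zL; apply: leq_addl.
apply: eqmod_trans zLn _.
have : eqmod (p ^ (k + n))%:R ((p ^ k)%:R * - L%:R : Zp) 0.
  exact: eqmod_trans (eqmod_sym (eqmodMl _ zL)) E.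
rewrite mulrN -natrM -[X in eqmod _ _ X]oppr0 => /(padic_opp_nat_eqmod p_pr _ _ 0).1.
rewrite mod0n => /eqP; rewrite -/(dvdn _ _) expnD dvdn_pmul2l ?expn_gt0 ?prime_gt0 // => nL.
by rewrite -[X in eqmod _ _ X]oppr0; apply/(padic_opp_nat_eqmod p_pr n L 0)/eqP; rewrite mod0n.
Qed.

Lemma padic_nat_split N : (0 < N)%N ->
  exists v : Zp, N%:R * v = (p ^ logn p N)%:R.
Proof.
move=> N0; have up : coprime N`_p^' p.
  by rewrite coprime_sym prime_coprime // -p'natE // part_pnat.
have [v vE] := padic_coprime_unit p_pr up.
by exists v; rewrite -{1}(partnC p N0) p_part natrM -mulrA vE mulr1.
Qed.

Lemma eqmod_padic_cancel N n x y : (0 < N)%N ->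
  eqmod (p ^ (n + logn p N))%:R (x * N%:R) (y * N%:R) -> eqmod (p ^ n)%:R x y.
Proof.
move=> N0 /(eqmodMr); have [v vE] := padic_nat_split N0 => /(_ v).
by rewrite -!mulrA vE ![_ * (p ^ _)%:R]mulrC addnC => /eqmod_padicX_cancel.
Qed.

Lemma padic_natI N x y : (0 < N)%N -> x * N%:R = y * N%:R -> x = y.
Proof.
move=> N0 E; apply/subr0_eq/padic_eq0 => n; apply: (eqmodB0 _ _ _).1.
by apply: (eqmod_padic_cancel N0); rewrite E; apply: eqmod_refl.
Qed.

Lemma exact_divE N x z : (0 < N)%N -> z * N%:R = x -> exact_div x N%:R = z.
Proof.
move=> N0 zx; rewrite /exact_div; case: xgetP => [y _ yx|/(_ z)]; last by [].
by apply: (padic_natI N0); rewrite zx.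
Qed.

(** Up to a p-adic unit, [N] is [p ^ logn p N]. *)
Lemma padic_dvd N x c : (0 < N)%N ->
  eqmod (p ^ logn p N)%:R x (c * N%:R) -> exists z, z * N%:R = x.
Proof.
move=> N0 [q ->]; have [v <-] := padic_nat_split N0.
by exists (c + v * q); rewrite mulrDl mulrAC [v * _]mulrC.
Qed.

Lemma dwork_digitE x n L : eqmod (p ^ n.+1)%:R x (- L%:R) -> dwork_digit x = (L %% p)%N.
Proof.
move=> /(eqmod_expn (ltn0Sn n)); rewrite expn1 => xL; have p0 := prime_gt0 p_pr.
have digit k : (k < p)%N -> eqmod p%:R (x + k%:R) 0 -> k = (L %% p)%N.
  move=> kp xk; rewrite -(modn_small kp); apply: (padic_opp_nat_eqmod p_pr 1 k L).1.
  rewrite expn1; apply: eqmod_trans xL; apply: eqmod_sym.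
  by have := eqmodD xk (eqmod_refl _ (- k%:R)); rewrite addrK add0r.
rewrite /dwork_digit; case: xgetP => [k _ [kp xk]|/(_ (L %% p)%N)]; first exact: digit.
case; split; first by rewrite ltn_mod.
apply: eqmod_trans (eqmodD xL (eqmod_nat Zp (modn_mod L p))) _.
by rewrite addNr; apply: eqmod_refl.
Qed.

Lemma dwork_primeE x : dwork_prime x * p%:R = x + (dwork_digit x)%:R.
Proof.
have [L _ xL] := padic_approx x 1.
have /eqmodD/(_ (eqmod_refl _ (L %% p)%:R)) := xL.
rewrite expn1 => E.
have [|z zE] := @padic_dvd p (x + (dwork_digit x)%:R) 0 (prime_gt0 p_pr).
  rewrite mul0r logn_prime // eqxx expn1 (dwork_digitE xL).
  apply: eqmod_trans E _; rewrite -(addNr L%:R).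
  by apply: eqmodD; [apply: eqmod_refl|apply: eqmod_nat; rewrite modn_mod].
by rewrite /dwork_prime (exact_divE (prime_gt0 p_pr) zE).
Qed.

(** The opposite of [L] becomes divisible by [p] on adding [L %% p], with quotient [- (L %/ p)]; the
    division by [p] costs one digit. *)
Lemma dwork_prime_eqmod x n L :
  eqmod (p ^ n.+1)%:R x (- L%:R) -> eqmod (p ^ n)%:R (dwork_prime x) (- (L %/ p)%:R).
Proof.
move=> xL; apply: (eqmod_padic_cancel (prime_gt0 p_pr)).
rewrite logn_prime // eqxx addn1 dwork_primeE (dwork_digitE xL) mulNr -natrM.
have -> : - (L %/ p * p)%:R = - L%:R + (L %% p)%:R :> Zp.
  by rewrite {2}(divn_eq L p) natrD opprD addrNK.
by apply: eqmodD => //; apply: eqmod_refl.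
Qed.

Lemma poch_eqmod m x y k : eqmod m x y -> eqmod m (poch x k) (poch y k).
Proof.
move=> xy; elim: k => [|k IH]; rewrite /poch ?big_ord0; first exact: eqmod_refl.
by rewrite !big_ord_recr; apply: eqmodM => //; apply: eqmodD => //; apply: eqmod_refl.
Qed.

Lemma poch_opp_nat L k : poch (- L%:R : Zp) k = (-1) ^+ k * 'C(L, k)%:R * (k`!)%:R.
Proof.
rewrite -mulrA -natrM bin_ffact; elim: k => [|k IH].
  by rewrite /poch big_ord0 mul1r ffactn0.
rewrite /poch big_ord_recr /= -/(poch _ k) IH ffactnSr natrM exprSr -!mulrA; congr (_ * _).
case: (leqP k L) => [kL|Lk]; last by rewrite ffact_small // mulr0n !mul0r mulr0.
by rewrite natrB // mulN1r -mulrN opprB addrC.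
Qed.

Section Hyperg.
Variable d : nat.
Local Notation F x := (hyperg (fun _ : 'I_d.+1 => x)).

Lemma hyperg_eqmod x k n L : eqmod (p ^ (n + logn p k`!))%:R x (- L%:R) ->
  eqmod (p ^ n)%:R (F x k) ((hypoly d.+1 L)`_k)%:~R.
Proof.
move=> xL; have k0 := fact_gt0 k.
have xE := poch_eqmod k xL; rewrite poch_opp_nat in xE.
have [z zx] : exists z, z * (k`!)%:R = poch x k.
  by apply: (padic_dvd k0); apply: eqmod_expn xE; apply: leq_addl.
have -> : F x k = z ^+ d.+1.
  rewrite /hyperg -natrX; apply: exact_divE; first by rewrite expn_gt0 k0.
  by rewrite natrX -exprMn zx prodr_const card_ord.
rewrite coef_hypoly [X in eqmod _ _ X]rmorphXn /= intrM rmorph_sign rmorph_nat.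
by apply/eqmodX/(eqmod_padic_cancel k0); rewrite zx.
Qed.

Lemma hyperg0 x : F x 0%N = 1.
Proof.
rewrite /hyperg fact0 expr1n; apply: (@exact_divE 1) => //.
by rewrite mulr1 big1 // => i _; rewrite /poch big_ord0.
Qed.

End Hyperg.
End PadicDivision.

(** * The Dwork series and its approximations *)

Lemma hypoly0 r : hypoly r 0 = 1.
Proof.
apply/polyP => -[|i]; rewrite coef_poly coef1 //=.
by rewrite expr0 mul1r bin0 expr1n.
Qed.

Lemma eqmod_comp_Xp (p : nat) (f : {poly int}) : prime p ->
  eqmod p%:R (f \Po 'X^p) (f ^+ p).
Proof.
move=> p_pr; elim/poly_ind: f => [|f c IH].
  by rewrite comp_poly0 expr0n eqn0Ngt prime_gt0 //; apply: eqmod_refl.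
apply/eqmod_sym/(eqmod_trans (eqmod_exprDp p_pr _ _)).
rewrite comp_polyD comp_polyM comp_polyX comp_polyC exprMn; apply: eqmodD.
  by apply/eqmodMr/eqmod_sym.
have -> : c%:P = c%:~R :> {poly int} by rewrite -[c in LHS]intz rmorph_int.
exact: eqmod_exprzp.
Qed.

Section Truncation.
Variables (p : nat) (p_pr : prime p) (d : nat) (x : padic p_pr).
Local Notation Zp := (padic p_pr).
Local Notation F x := (hyperg (fun _ : 'I_d.+1 => x)).
Local Notation b := (fun _ : 'I_d.+1 => x).
Local Notation x_ i := (iter i (@dwork_prime p p_pr) x).
Local Notation PZ L := (map_poly (intmul (1 : padic p_pr)) (hypoly d.+1 L)).
Local Notation PZp L := (PZ L \Po 'X^p).

Let p_gt0 : (0 < p)%N := prime_gt0 p_pr.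

Lemma map_hypoly_congruence s L M : L = M %[mod p ^ s] ->
  eqmod (p ^ s)%:R (PZ L * PZp (M %/ p)) (PZ M * PZp (L %/ p)).
Proof.
move=> /(hypoly_congruence d p_pr)/(eqmod_rmorph (map_poly (intmul (1 : Zp)))).
by rewrite !rmorphM /= !map_comp_poly !map_polyXn rmorph_nat.
Qed.

Lemma logn_fact_leq i K : (i <= K)%N -> (logn p i`! <= logn p K`!)%N.
Proof.
move=> iK; apply: dvdn_leq_log; first exact: fact_gt0.
by rewrite -(bin_fact iK) dvdn_mull // dvdn_mulr.
Qed.

(** For each coefficient, both series are replaced by the polynomials of a finer approximation [- N]
    of [x], and the congruence of [hypoly] is applied between [N] and [L]. *)
Lemma hyperg_congruence n L : eqmod (p ^ n)%:R x (- L%:R) ->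
  eqmod (p ^ n)%:R (F x * of_poly (PZp (L %/ p)))
    (ps_expand p (F (dwork_prime x)) * of_poly (PZ L)).
Proof.
(* [m] pays for the division by the factorials up to that of [K], and the extra digit of [m.+1] for
   the passage to the Dwork prime. *)
move=> xL; apply/eqmod_psP => K; pose m := (n + logn p K`!)%N.
have [N _ xN] := padic_approx x m.+1.
have x'N := dwork_prime_eqmod xN.
have FE i : (i <= K)%N -> eqmod (p ^ n)%:R (F x i) (PZ N)`_i.
  move=> iK; rewrite coef_map; apply: hyperg_eqmod; apply: eqmod_expn xN.
  by rewrite leqW // leq_add2l logn_fact_leq.
have F'E i : (i <= K)%N ->
    eqmod (p ^ n)%:R (ps_expand p (F (dwork_prime x)) i) (PZp (N %/ p))`_i.
  move=> iK; rewrite coef_comp_poly_Xn // /ps_expand; case: ifP => _; last exact: eqmod_refl.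
  rewrite coef_map; apply: hyperg_eqmod; apply: eqmod_expn x'N.
  by rewrite leq_add2l logn_fact_leq // (leq_trans (leq_div _ _)).
have NL : N = L %[mod p ^ n].
  apply/padic_opp_nat_eqmod/(eqmod_trans _ xL)/eqmod_sym/(eqmod_expn _ xN).
  by rewrite leqW // leq_addr.
have /(eqmod_rmorph (@of_poly Zp)) := map_hypoly_congruence NL.
rewrite !rmorphM rmorph_nat => /eqmod_psP/(_ K) NLE.
apply: (@eqmod_trans _ _ _ ((of_poly (PZ N) * of_poly (PZp (L %/ p))) K)).
  rewrite !psM; apply: eqmod_sum => i _; apply: eqmodMr; apply: FE.
  by rewrite -ltnS.
apply: eqmod_trans NLE _; rewrite mulrC !psM; apply: eqmod_sum => i _.
by apply/eqmodMr/eqmod_sym/F'E; rewrite -ltnS.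
Qed.

Lemma dwork_series_congruence n L : eqmod (p ^ n)%:R x (- L%:R) ->
  eqmod (p ^ n)%:R (dwork_series b * of_poly (PZp (L %/ p))) (of_poly (PZ L)).
Proof.
move=> /hyperg_congruence; set E := ps_expand _ _.
have E0 : E 0%N = 1 by rewrite /E /ps_expand dvdn0 div0n hyperg0.
have -> : F x = E * dwork_series b by rewrite mulrC /dwork_series divrK // ps_unit.
by rewrite -mulrA; apply: eqmod_cancel.
Qed.

Lemma iter_dwork_primes i : iter i (@dwork_primes p p_pr d) b = (fun=> x_ i).
Proof. by elim: i => //= i ->. Qed.

(** For [k < p] the factorial of [k] is prime to [p], so the parameter modulo [p] determines the
    coefficient modulo [p]; and [PZ L] has no term of degree [p] or more. *)
Lemma hyperg_lt_eqmod i L : (L < p)%N -> eqmod p%:R (x_ i) (- L%:R) ->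
  eqmod p%:R (hyperg_lt b i) (PZ L).
Proof.
move=> Lp xL; apply/eqmod_polyP => k; rewrite coef_poly iter_dwork_primes.
case: ltnP => [kp|pk]; last first.
  rewrite coef_map coef_poly ltnNge (leq_trans Lp pk) /=; exact: eqmod_refl.
rewrite coef_map; suff: eqmod (p ^ 1)%:R (F (x_ i) k) ((hypoly d.+1 L)`_k)%:~R.
  by rewrite expn1.
apply: hyperg_eqmod.
suff -> : logn p k`! = 0%N by rewrite addn0 expn1.
rewrite logn_fact // big_nat big1 // => j /andP[j0 _].
by rewrite divn_small // (leq_trans kp) // -{1}(expn1 p) leq_pexp2l.
Qed.

Section Divisors.
Variables (h : {poly Zp}).

(** This says that [f] becomes invertible modulo [p] once [h] is inverted. *)
Definition divides_power (f : {poly Zp}) : Prop :=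
  exists q k, eqmod p%:R (f * q) (h ^+ k).

Lemma divides_powerM f g : divides_power f -> divides_power g -> divides_power (f * g).
Proof.
move=> [q [k qk]] [q' [k' qk']]; exists (q * q'), (k + k')%N.
by rewrite mulrACA exprD; apply: eqmodM.
Qed.

Lemma divides_power_eqmod f g : eqmod p%:R f g -> divides_power f -> divides_power g.
Proof.
move=> fg [q [k qk]]; exists q, k.
by apply: eqmod_trans qk; apply/eqmodMr/eqmod_sym.
Qed.

Lemma divides_power1 : divides_power 1.
Proof. by exists 1, 0%N; rewrite mul1r; apply: eqmod_refl. Qed.

Lemma divides_powerX f n : divides_power f -> divides_power (f ^+ n).
Proof.
move=> fh; elim: n => [|n IH]; first exact: divides_power1.
by rewrite exprS; apply: divides_powerM.
Qed.

(** Raising a congruence modulo [p] to the power [p ^ n] makes it hold modulo [p ^ n.+1]. *)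
Lemma divides_power_lift f n : divides_power f ->
  exists q k, eqmod (p ^ n)%:R (f * q) (h ^+ k).
Proof.
move=> [q [k /(eqmod_frobX n)/(eqmod_expn (leqnSn n)) E]].
exists (f ^+ (p ^ n).-1 * q ^+ (p ^ n)), (k * p ^ n)%N.
by rewrite mulrA -exprS prednK ?expn_gt0 ?p_gt0 // -exprMn exprM.
Qed.

Lemma divides_power_comp_Xp L :
  divides_power (PZ L) -> divides_power (PZp L).
Proof.
move=> /(divides_powerX p); apply: divides_power_eqmod; apply: eqmod_sym.
have := eqmod_rmorph (map_poly (intmul (1 : Zp))) (eqmod_comp_Xp (hypoly d.+1 L) p_pr).
by rewrite /= rmorph_nat rmorphXn map_comp_poly map_polyXn.
Qed.

End Divisors.

Section LargeEnough.
Variable M : nat.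
Hypothesis HM : large_enough b M.
Local Notation h := (hpoly b M).

Lemma hyperg_lt_dvd i : divides_power h (hyperg_lt b i).
Proof.
have [j /andP[j1 jM] ij] := HM i; apply: divides_power_eqmod (eqmod_sym ij) _.
exists (\prod_(1 <= k < M.+1 | k != j) hyperg_lt b k), 1%N; rewrite expr1 /hpoly.
rewrite [in X in eqmod _ _ X](bigD1_seq j) ?iota_uniq //=; first exact: eqmod_refl.
by rewrite mem_index_iota j1.
Qed.

(** As in Lucas' theorem, [P_L(t)] is [P_(L %% p)(t) * P_(L %/ p)(t^p)] modulo [p]. The first factor
    is the reduction of [hyperg_lt b i]; the second is handled by induction, at the next Dwork
    prime. *)
Lemma hypoly_dvd n i L : (L < p ^ n)%N -> eqmod (p ^ n)%:R (x_ i) (- L%:R) ->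
  divides_power h (PZ L).
Proof.
elim: n i L => [|n IH] i L.
  rewrite ltnS leqn0 => /eqP -> _; rewrite hypoly0 rmorph1; exact: divides_power1.
move=> Ln xL.
(* The Dwork congruence modulo [p] between [L] and its last digit, whose quotient by [p] is [0]. *)
have LL : L = L %% p %[mod p ^ 1] by rewrite expn1 modn_mod.
have := map_hypoly_congruence LL.
rewrite (divn_small (_ : (L %% p < p)%N)) ?ltn_mod // hypoly0 rmorph1 comp_polyC mulr1 expn1.
move=> /eqmod_sym/divides_power_eqmod; apply; apply: divides_powerM.
  apply: divides_power_eqmod (hyperg_lt_dvd i); apply: hyperg_lt_eqmod; rewrite ?ltn_mod //.
  have := eqmod_expn (ltn0Sn n) xL; rewrite expn1 => /eqmod_trans; apply.
  by apply/eqmodN/eqmod_nat; rewrite modn_mod.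
apply: divides_power_comp_Xp; apply: (IH i.+1); last exact: dwork_prime_eqmod.
by rewrite ltn_divLR // -expnSr.
Qed.

End LargeEnough.
End Truncation.

(** * The completed ring and its inversion *)

(* Not [GRing.unit]: the quotients of [padic_t] may be trivial rings. *)
Section Invertible.
Variable R : comPzRingType.
Implicit Types x y z : R.

Definition invertible x := exists y, x * y = 1.

Lemma invertibleM x y : invertible x -> invertible y -> invertible (x * y).
Proof. by move=> [x' xx'] [y' yy']; exists (x' * y'); rewrite mulrACA xx' yy' mulr1. Qed.

Lemma invertible_mull x y : invertible (x * y) -> invertible x.
Proof. by move=> [z xyz]; exists (y * z); rewrite mulrA. Qed.

Lemma invertibleX x n : invertible x -> invertible (x ^+ n).
Proof. by move=> [y xy]; exists (y ^+ n); rewrite -exprMn xy expr1n. Qed.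

Lemma invertible_inj x y z : invertible x -> x * y = x * z -> y = z.
Proof. by move=> [x' xx'] /(congr1 ( *%R x')); rewrite !mulrA [x' * x]mulrC xx' !mul1r. Qed.

Lemma invertible_cross_inj a b x y : invertible a -> invertible b ->
  x * a * b = y * b * a -> x = y.
Proof.
move=> aU bU xy; apply: (invertible_inj (invertibleM aU bU)).
by rewrite mulrC mulrA xy mulrAC -mulrA mulrC.
Qed.

Lemma invertible_eqmod (p n : nat) x y : (0 < p)%N -> (p ^ n)%:R = 0 :> R ->
  eqmod p%:R x y -> invertible y -> invertible x.
Proof.
move=> p0 pn0 /(eqmod_frobX n)/(eqmod_expn (leqnSn n))[q].
rewrite pn0 mul0r addr0 => E yU; apply: (@invertible_mull _ (x ^+ (p ^ n).-1)).
by rewrite -exprS prednK ?expn_gt0 ?p0 // E; apply: invertibleX.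
Qed.

End Invertible.

Lemma coef_hypoly_sub d L k : (k <= L)%N ->
  (hypoly d.+1 L)`_k = ((-1) ^+ d.+1) ^+ L * (hypoly d.+1 L)`_(L - k).
Proof.
move=> kL; rewrite !coef_hypoly -exprM mulnC exprM -exprMn bin_sub // mulrA -exprD.
congr ((_ * _) ^+ _); rewrite -signr_odd -[RHS]signr_odd oddD oddB //.
by rewrite addbA addbb.
Qed.

(** * Reciprocity under inversion of the variable *)

Section Reciprocal.
Variables (p : nat) (p_pr : prime p) (d : nat) (R : comPzRingType).
Local Notation Zp := (padic p_pr).
Local Notation PZ L := (map_poly (intmul (1 : padic p_pr)) (hypoly d.+1 L)).

Lemma rmorph_hypoly (f : {rmorphism {poly Zp} -> R}) L :
  f (PZ L) = \sum_(k < L.+1) ((hypoly d.+1 L)`_k)%:~R * f 'X ^+ k.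
Proof.
have -> : PZ L = \sum_(k < L.+1) ((hypoly d.+1 L)`_k)%:~R * 'X^k.
  rewrite {1}[hypoly _ _]poly_def rmorph_sum; apply: eq_bigr => k _ /=.
  rewrite -coef_hypoly -mul_polyC rmorphM /= map_polyXn map_polyC; congr (_ * _).
  exact: rmorph_int.
by rewrite rmorph_sum; apply: eq_bigr => k _; rewrite rmorphM rmorph_int rmorphXn.
Qed.

(* [hypoly] is palindromic up to sign, as ['C(L, k) = 'C(L, L - k)]. *)
Lemma hypoly_reciprocal (f g : {rmorphism {poly Zp} -> R}) L :
  g 'X * f 'X = 1 -> g (PZ L) * f 'X ^+ L = ((-1) ^+ d.+1) ^+ L * f (PZ L).
Proof.
move=> gf; rewrite !rmorph_hypoly mulr_suml mulr_sumr.
rewrite [RHS](reindex_inj rev_ord_inj) /=; apply: eq_bigr => k _; rewrite subSS.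
have kL : (k <= L)%N by rewrite -ltnS.
have -> : f 'X ^+ L = f 'X ^+ k * f 'X ^+ (L - k) by rewrite -exprD subnKC.
rewrite -mulrA [_ ^+ k * _]mulrA -exprMn gf expr1n mul1r mulrA; congr (_ * _).
rewrite (coef_hypoly_sub d kL) rmorphM /= !rmorphXn /=.
by rewrite rmorphN1.
Qed.

End Reciprocal.

Section CompletedRing.
Variables (p : nat) (p_pr : prime p) (h : {poly padic p_pr}).
Local Notation Zp := (padic p_pr).

Definition level n : seq {poly {poly Zp}} := [:: (p ^ n)%:R; ('X * h)%:P * 'X - 1].
Definition red n : {poly {poly Zp}} -> qring (level n) := to_q (level n).
HB.instance Definition _ n := GRing.RMorphism.copy (red n) (to_q (level n)).

Let p_gt0 : (0 < p)%N := prime_gt0 p_pr.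

Lemma redM n : {morph red n : x y / x * y}. Proof. exact: rmorphM. Qed.
Lemma redD n : {morph red n : x y / x + y}. Proof. exact: rmorphD. Qed.
Lemma redB n : {morph red n : x y / x - y}. Proof. exact: rmorphB. Qed.
Lemma redX n k : {morph red n : x / x ^+ k}. Proof. by move=> x; apply: rmorphXn. Qed.
Lemma red1 n : red n 1 = 1. Proof. exact: rmorph1. Qed.

Lemma padic_t_decr n x : x \in ideal (level n.+1) -> x \in ideal (level n).
Proof.
move=> /ideal2P[c [e ->]]; apply/ideal2P; exists (c * p%:R), e.
by rewrite expnS natrM mulrA.
Qed.

Lemma red_pX n : (p ^ n)%:R = 0 :> qring (level n).
Proof.
by rewrite -(rmorph_nat (red n)); apply/to_q_eq0/ideal2l.
Qed.

Lemma red_eqmod n x y : eqmod (p ^ n)%:R x y -> red n x = red n y.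
Proof.
move=> /(eqmod_rmorph (red n)); rewrite rmorph_nat => -[q ->].
by rewrite red_pX mul0r addr0.
Qed.

Lemma red_polyC_eqmod n (f g : {poly Zp}) : eqmod (p ^ n)%:R f g -> red n f%:P = red n g%:P.
Proof. by move=> /(eqmod_rmorph polyC); rewrite rmorph_nat => /red_eqmod. Qed.

Lemma red_polyC_eqmodM n (f g f' g' : {poly Zp}) :
  eqmod (p ^ n)%:R (f * g) (f' * g') ->
  red n f%:P * red n g%:P = red n f'%:P * red n g'%:P.
Proof. by move=> /red_polyC_eqmod E; rewrite -!redM -!polyCM. Qed.

(** The outer ['X] stands for the inverse of [t * h], so [h%:P * 'X] represents [t^-1] and
    ['X%:P * 'X] represents [h^-1]. *)
Lemma red_inv n : red n (h%:P * 'X) * red n 'X%:P = 1.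
Proof.
rewrite -redM -(red1 n) mulrAC -polyCM [h * _]mulrC.
exact/to_q_eqP/ideal2r.
Qed.

Lemma red_hinv n : red n h%:P * red n ('X%:P * 'X) = 1.
Proof. by rewrite -(red_inv n) -!rmorphM mulrA mulrAC. Qed.

Lemma red_h_invertible n : invertible (red n h%:P).
Proof. by eexists; apply: red_hinv. Qed.

Lemma red_divisor_invertible n f : divides_power h f -> invertible (red n f%:P).
Proof.
move=> /(divides_power_lift n)[q [k /red_polyC_eqmod]].
rewrite polyCM rmorphM rmorphXn rmorphXn => E.
by apply: (@invertible_mull _ _ (red n q%:P)); rewrite E; apply/invertibleX/red_h_invertible.
Qed.

(* Clearing denominators in [Zp[t][1 / (t * h)]]. *)
Lemma red_polyC_eq0 n g : red n g%:P = 0 ->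
  exists k, eqmod (p ^ n)%:R (('X * h) ^+ k * g) 0.
Proof.
move=> /to_q_eq0/ideal2P[c [e gE]]; exists (size e).
suff E k : eqmod (p ^ n)%:R (('X * h) ^+ k * g) (- e`_k).
  by have := E (size e); rewrite nth_default // oppr0.
have coefE i : (g%:P)`_i =
    c`_i * (p ^ n)%:R + ('X * h) * (if i == 0%N then 0 else e`_i.-1) - e`_i.
  rewrite gE coefD -(rmorph_nat polyC) coefMC mulrBr mulr1 coefB mulrA coefMX addrA.
  by case: i => [|i] /=; rewrite ?mulr0 // coefMC [e`_i * _]mulrC.
elim: k => [|k IH].
  have := coefE 0%N; rewrite coefC eqxx mulr0 addr0 mul1r => ->.
  by exists c`_0; rewrite addrC mulrC.
have := coefE k.+1; rewrite coefC /= => /esym/subr0_eq E.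
rewrite exprS -mulrA; apply: eqmod_trans (eqmodMl _ IH) _; rewrite -E mulrN.
by exists c`_k.+1; rewrite opprD addrAC [_%:R * _]mulrC addNr add0r.
Qed.

Section Inversion.
(** The element required to be invertible is [h(t^-1)]. *)
Hypothesis h_inv : forall n, exists v,
  red n ((map_poly (polyC \o polyC) h).[h%:P * 'X] * v) = 1.

Let T : {poly {poly Zp}} := h%:P * 'X.
Let evT : {rmorphism {poly Zp} -> {poly {poly Zp}}} :=
  horner_eval T \o map_poly (polyC \o polyC).

(** [E n] substitutes [t^-1] for [t] and [V n] for the inverse of [t * h]. It respects the relations
    at level [n], and these substitutions are compatible between levels. *)
Lemma tinv_exists : exists f : padic_t h -> padic_t h,
  [/\ zmod_morphism f, monoid_morphism f, f tvar * tvar = 1 &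
        forall n (x y : padic_t h), proj x n = proj y n -> proj (f x) n = proj (f y) n].
Proof.
have evTX : evT 'X = T by rewrite /evT /= map_polyX /horner_eval hornerX.
(* [V n] has to invert [t^-1 * h(t^-1)]: it is [t] times the inverse given by [h_inv]. *)
have /choice[V VE] n : exists V, red n (T * evT h * V) = 1.
  have [v vE] := h_inv n; exists (v * 'X%:P).
  by rewrite [v * _]mulrC mulrACA redM [red n (T * _)]redM red_inv mul1r.
pose E n : {rmorphism _ -> _} := horner_eval (V n) \o map_poly evT.
have EC n g : E n g%:P = evT g by rewrite /E /= map_polyC /horner_eval hornerC.
have EX n : E n 'X = V n by rewrite /E /= map_polyX /horner_eval hornerX.
have E0 n x : red n x = 0 -> red n (E n x) = 0.
  move=> /to_q_eq0/ideal2P[c [e ->]].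
  have -> : E n (c * (p ^ n)%:R + e * (('X * h)%:P * 'X - 1)) =
      E n c * (p ^ n)%:R + E n e * (E n ('X * h)%:P * E n 'X - 1).
    by rewrite rmorphD [E n (c * _)]rmorphM [E n (e * _)]rmorphM rmorph_nat rmorphB
      [E n (_ * 'X)]rmorphM rmorph1.
  rewrite EC EX [evT _]rmorphM evTX redD !redM redB red1 VE subrr mulr0 addr0.
  by rewrite [red n _%:R](rmorph_nat (red n)) red_pX mulr0.
have Ewd n x y : red n x = red n y -> red n (E n x) = red n (E n y).
  move=> xy; apply/subr0_eq; rewrite -redB -(rmorphB (E n)).
  by apply: E0; rewrite redB xy subrr.
have piS n x y : red n.+1 x = red n.+1 y -> red n x = red n y.
  by move=> /to_q_eqP xy; apply/to_q_eqP/padic_t_decr.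
(* The evaluations at successive levels differ only in the chosen [V], and these agree at level [n]
   by uniqueness of inverses. *)
have ES n g : red n (E n g) = red n (E n.+1 g).
  have VS : red n (V n) = red n (V n.+1).
    apply: (@invertible_inj _ (red n (T * evT h))).
      by exists (red n (V n)); rewrite -redM VE.
    by rewrite -!redM VE; apply/esym/(piS n); rewrite VE red1.
  rewrite /E /= /horner_eval !horner_coef !rmorph_sum; apply: eq_bigr => i _.
  by rewrite /= !redM !redX VS.
have /choice[G GE] (x : padic_t h) : exists g, forall n, proj x n = red n (g n).
  exact: ilim_reprs.
have coh x : `[< coherent (fun n => red n (E n (G x n))) >].
  apply/asboolP => n; exists (E n.+1 (G x n.+1)); split=> //.
  rewrite -[RHS]/(red n _) -ES; apply: Ewd; rewrite -GE.
  by apply: (proj_leq padic_t_decr (leqnSn n)); apply: GE.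
exists (fun x => Ilim (coh x)); split.
- move=> x y; apply: ilimP => n /=.
  rewrite -[RHS]/(red n (E n (G x n)) - red n (E n (G y n))) -redB -(rmorphB (E n)).
  by apply: Ewd; rewrite -GE redB -!GE.
- split.
    apply: ilimP => n; transitivity (red n (E n 1)); last by rewrite rmorph1 red1.
    by apply: Ewd; rewrite -GE red1.
  move=> x y; apply: ilimP => n /=.
  rewrite -[RHS]/(red n (E n (G x n)) * red n (E n (G y n))) -redM -(rmorphM (E n)).
  by apply: Ewd; rewrite -GE redM -!GE.
- apply: ilimP => n; rewrite -[LHS]/(red n (E n (G tvar n)) * red n 'X%:P).
  rewrite -[RHS](red_inv n); congr (_ * _); rewrite -[h%:P * 'X]evTX -(EC n).
  by apply: Ewd; rewrite -GE.
by move=> n x y /=; rewrite !GE; apply: Ewd.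
Qed.

End Inversion.
End CompletedRing.

(** * The Dwork function *)

Lemma ilim_projMn (A : comPzRingType) (s : nat -> seq A) (x : ilim s) k n :
  proj (x *+ k) n = proj x n *+ k.
Proof. by elim: k => [|k IH]; [apply: raddf0|rewrite !mulrS -IH]. Qed.

Section DworkFunction.
Variables (p : nat) (p_pr : prime p) (d : nat) (x : padic p_pr) (M : nat).
Local Notation Zp := (padic p_pr).
Local Notation b := (fun _ : 'I_d.+1 => x).
Hypothesis HM : large_enough b M.
Local Notation h := (hpoly b M).
Local Notation x_ i := (iter i (@dwork_prime p p_pr) x).
Local Notation PZ L := (map_poly (intmul (1 : padic p_pr)) (hypoly d.+1 L)).
Local Notation PZp L := (PZ L \Po 'X^p).
Local Notation red n := (@red p p_pr h n).
Local Notation eps := ((-1) ^+ d.+1).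

Let p_gt0 : (0 < p)%N := prime_gt0 p_pr.

Lemma red_hypoly_invertible m n L : (L < p ^ m.+1)%N -> eqmod (p ^ m.+1)%:R x (- L%:R) ->
  invertible (red n (PZ L)%:P) /\ invertible (red n (PZp (L %/ p))%:P).
Proof.
move=> Lm xL; split; apply: red_divisor_invertible.
  exact: (hypoly_dvd HM (i := 0%N) Lm xL).
apply: divides_power_comp_Xp; apply: (hypoly_dvd HM (n := m) (i := 1%N)).
  by rewrite ltn_divLR // -expnSr.
exact: dwork_prime_eqmod.
Qed.

(** Modulo [p], which is nilpotent here, each factor of [h] is some [PZ L]. By reciprocity its value
    at [t^-1] times [t^L] is, up to sign, its value at [t], which divides a power of [h]. *)
Lemma hpoly_inversion n :
  exists v, red n ((map_poly (polyC \o polyC) h).[h%:P * 'X] * v) = 1.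
Proof.
pose psi : {rmorphism {poly Zp} -> qring (level h n)} :=
  red n \o (horner_eval (h%:P * 'X) \o map_poly (polyC \o polyC)).
suff [y yE] : invertible (psi h).
  have [v vE] := to_q_surj y; exists v; rewrite redM; move: yE; rewrite -vE; exact.
have -> : psi h = \prod_(1 <= i < M.+1) psi (hyperg_lt b i) by apply: rmorph_prod.
rewrite big_nat; apply: big_ind => [||i /andP[i1 iM]].
- by exists 1; rewrite mulr1.
- exact: invertibleM.
have [L Lp xL] := padic_approx (x_ i) 1; have Lh := hypoly_dvd HM Lp xL.
move: Lp xL; rewrite expn1 => Lp /(hyperg_lt_eqmod d Lp)/(eqmod_rmorph psi).
rewrite rmorph_nat => /(invertible_eqmod p_gt0 (red_pX h n)); apply.
pose phi : {rmorphism {poly Zp} -> qring (level h n)} := red n \o polyC.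
have psiX : psi 'X * phi 'X = 1.
  by rewrite /= map_polyX /horner_eval hornerX; apply: red_inv.
apply: (@invertible_mull _ _ (phi 'X ^+ L)); rewrite hypoly_reciprocal //.
apply: invertibleM; last exact: (red_divisor_invertible n Lh).
by do 2 apply: invertibleX; exists (-1); rewrite mulrNN mulr1.
Qed.

Lemma tinvP : [/\ zmod_morphism (@tinv p p_pr h), monoid_morphism (@tinv p p_pr h),
  tinv tvar * tvar = 1 :> padic_t h &
  forall n (y z : padic_t h), proj y n = proj z n -> proj (tinv y) n = proj (tinv z) n].
Proof. exact: (xgetPex (fun y : padic_t h => y) (tinv_exists hpoly_inversion)). Qed.

Definition expands_dwork_series (D : padic_t h) : Prop :=
  forall n, exists (g : {poly Zp}) (k : nat),
    proj D n * proj (poly_padic_t h (h ^+ k)) n = proj (poly_padic_t h g) n /\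
    eqmod (p ^ n)%:R (dwork_series b * of_poly (h ^+ k)) (of_poly g).

(** Both fractions [g / h^k] and [P_L(t) / P_(L %/ p)(t^p)] expand to the Dwork series modulo
    [p ^ n]; cross-multiplied, this is a congruence of polynomials, after which [h^k] is
    cancelled. *)
Lemma expands_dwork_seriesP (D : padic_t h) n L : expands_dwork_series D ->
  eqmod (p ^ n)%:R x (- L%:R) ->
  proj D n * red n (PZp (L %/ p))%:P = red n (PZ L)%:P.
Proof.
move=> /(_ n)[g [k [Dg dwg]]] /dwork_series_congruence dwL.
have : eqmod (p ^ n)%:R (g * PZp (L %/ p)) (h ^+ k * PZ L).
  apply/eqmod_of_poly; rewrite !rmorphM.
  apply: eqmod_trans (eqmodMr _ (eqmod_sym dwg)) _.
  by rewrite mulrAC [X in eqmod _ _ X]mulrC; apply: eqmodMr.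
move=> /(red_polyC_eqmod h); rewrite !polyCM !redM => E.
apply: (@invertible_inj _ (red n (h ^+ k)%:P)).
  by rewrite polyC_exp redX; apply: invertibleX; apply: red_h_invertible.
by rewrite -E -[red n g%:P]Dg mulrCA mulrA.
Qed.

(** Level [n] is given the fraction [P_L(t) / P_(L %/ p)(t^p)], with its denominator inverted
    through [h]; coherence is the Dwork congruence. *)
Lemma dwork_series_expansion : exists D, expands_dwork_series D.
Proof.
(* The additional digit makes [L n %/ p] an approximation of the Dwork prime modulo [p ^ n]. *)
have /choice[L LP] n : exists L, (L < p ^ n.+1)%N /\ eqmod (p ^ n.+1)%:R x (- L%:R).
  by have [L L1 L2] := padic_approx x n.+1; exists L.
have /choice[q qP] n : exists q : {poly Zp} * nat,
    eqmod (p ^ n)%:R (PZp (L n %/ p) * q.1) (h ^+ q.2).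
  have [Ln xL] := LP n; have x'L := dwork_prime_eqmod xL.
  have /divides_power_comp_Xp/(divides_power_lift n)[q [k qk]] :
      divides_power h (PZ (L n %/ p)).
    by apply: (hypoly_dvd HM (n := n) (i := 1%N)) x'L; rewrite ltn_divLR // -expnSr.
  by exists (q, k).
(* The inverse of the denominator is [q / h^k], and ['X%:P * 'X] represents [h^-1]. *)
pose G n : {poly {poly Zp}} := (PZ (L n) * (q n).1)%:P * ('X%:P * 'X) ^+ (q n).2.
have GE n m : (n <= m)%N ->
    red n (G m) * red n (PZp (L m %/ p))%:P = red n (PZ (L m))%:P.
  move=> nm; have /(red_polyC_eqmod h) := eqmod_expn nm (qP m).
  rewrite polyCM redM polyC_exp redX => E.
  rewrite /G redM redX polyCM redM -!mulrA -[RHS]mulr1; congr (_ * _).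
  rewrite mulrCA [X in _ * X]mulrC E -exprMn [_ * red n h%:P]mulrC.
  by rewrite red_hinv expr1n.
have coh : `[< coherent (fun n => to_q (level h n) (G n)) >].
  apply/asboolP => n; exists (G n.+1); split=> //.
  rewrite -[LHS]/(red n _) -[RHS]/(red n _).
  have [Ln xLn] := LP n; have [Lm xLm] := LP n.+1.
  have [_ U1] := red_hypoly_invertible n Ln xLn.
  have [_ U2] := red_hypoly_invertible n Lm xLm.
  have LL : L n = L n.+1 %[mod p ^ n].
    apply/(padic_opp_nat_eqmod p_pr)/(@eqmod_trans _ _ _ x); first apply: eqmod_sym.
      exact: eqmod_expn xLn.
    by apply: eqmod_expn xLm; apply: leqW.
  apply: (invertible_cross_inj U1 U2).
  rewrite (GE n n (leqnn n)) (GE n n.+1 (leqnSn n)).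
  exact: (red_polyC_eqmodM h (map_hypoly_congruence p_pr d LL)).
exists (Ilim coh) => n; exists (PZ (L n) * (q n).1), (q n).2; split.
  rewrite -[LHS]/(red n (G n) * red n (h ^+ (q n).2)%:P) -[RHS]/(red n _%:P).
  rewrite /G redM -mulrA polyC_exp !redX -exprMn.
  by rewrite [red n ('X%:P * _) * _]mulrC red_hinv expr1n mulr1.
have [_ xL] := LP n.
have dwL := dwork_series_congruence d (eqmod_expn (leqnSn n) xL).
move: (dwork_series b) dwL => w dwL.
have := eqmodMr (of_poly (q n).1) dwL; rewrite -!mulrA -!rmorphM.
move=> E; apply: eqmod_trans E.
by apply/eqmodMl/eqmod_sym/eqmod_of_poly.
Qed.

Lemma dwork_funP : expands_dwork_series (dwork_fun b M).
Proof. exact: (xgetPex 0 dwork_series_expansion). Qed.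

(** At level [n] the function is [P_L(t) / P_(L %/ p)(t^p)]. Inverting [t] multiplies the numerator
    by [eps^L * t^(- L)] and the denominator by [eps^(L %/ p) * t^(- p * (L %/ p))], which leaves a
    sign and [t^(L %% p)]. *)
Lemma dwork_fun_tinv m n L : (n <= m.+1)%N ->
  (L < p ^ m.+1)%N -> eqmod (p ^ m.+1)%:R x (- L%:R) ->
  proj (dwork_fun b M) n =
  proj (eps ^+ (L + L %/ p) * tvar ^+ (L %% p) * tinv (dwork_fun b M)) n.
Proof.
move=> nm Lm xL; set D := dwork_fun b M.
have [tB tM tt tproj] := tinvP.
pose f : {rmorphism padic_t h -> padic_t h} := HB.pack (@tinv p p_pr h)
  (GRing.isZmodMorphism.Build _ _ _ tB) (GRing.isMonoidMorphism.Build _ _ _ tM).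
pose phi : {rmorphism {poly Zp} -> padic_t h} := to_lim _ \o polyC.
have DE := expands_dwork_seriesP dwork_funP (eqmod_expn nm xL).
(* [DE] holds only at level [n]; [tinv] may be applied to it because it acts on each level. *)
have fDE : proj (f D * f (phi (PZp (L %/ p)))) n = proj (f (phi (PZ L))) n.
  by rewrite -rmorphM; apply: tproj; rewrite -[RHS]DE.
have E1 : f (phi (PZ L)) * tvar ^+ L = eps ^+ L * phi (PZ L).
  exact: (@hypoly_reciprocal p p_pr d _ phi (f \o phi) L tt).
(* Reciprocity in the variable [t^p]. *)
have E2 : f (phi (PZp (L %/ p))) * (tvar ^+ p) ^+ (L %/ p) =
    eps ^+ (L %/ p) * phi (PZp (L %/ p)).
  pose phi_p : {rmorphism {poly Zp} -> padic_t h} := phi \o comp_poly 'X^p.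
  have phi_pX : phi_p 'X = tvar ^+ p by rewrite /= comp_polyX polyC_exp rmorphXn.
  rewrite -phi_pX; apply: (@hypoly_reciprocal p p_pr d _ phi_p (f \o phi_p)).
  by rewrite -[_ 'X in X in X * _]/(f (phi_p 'X)) phi_pX rmorphXn -exprMn tt expr1n.
have [_ U] := red_hypoly_invertible n Lm xL.
apply: (invertible_inj U); rewrite mulrC [LHS]DE.
have : proj (eps ^+ L * phi (PZ L)) n =
  proj (f D * tvar ^+ (L %% p) * (eps ^+ (L %/ p) * phi (PZp (L %/ p)))) n.
  rewrite -E1 -E2.
  transitivity (proj (f D * f (phi (PZp (L %/ p))) * tvar ^+ L) n).
    by rewrite -[LHS]/(proj _ n * proj _ n) -fDE.
  have -> : tvar ^+ L = tvar ^+ (L %% p) * (tvar ^+ p) ^+ (L %/ p) :> padic_t h.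
    by rewrite -exprM -exprD mulnC addnC -divn_eq.
  by rewrite mulrACA.
rewrite -[red n _]/(proj (phi (PZ L)) n) -[red n _]/(proj (phi (PZp (L %/ p))) n) => E.
transitivity (proj (eps ^+ L * (eps ^+ L * phi (PZ L))) n).
  by rewrite mulrA -exprMn -exprD addnn -signr_odd odd_double expr1n mul1r.
rewrite -[LHS]/(proj (eps ^+ L) n * proj (eps ^+ L * phi (PZ L)) n) E.
rewrite -[LHS]/(proj (_ * _) n) -[RHS]/(proj (_ * _) n); congr (proj _ n).
rewrite exprD [RHS]mulrC -!mulrA; congr (_ * _).
by rewrite mulrCA [f D * (_ * _)]mulrCA mulrCA.
Qed.

Lemma hpoly_at0 : h`_0 = 1.
Proof.
rewrite -horner_coef0 /hpoly horner_prod; apply: big1 => i _.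
by rewrite horner_coef0 coef_poly p_gt0 iter_dwork_primes hyperg0.
Qed.

(** This separates the two signs when [p = 2]. The numerator of the function being invertible at
    level [2], [p] would otherwise vanish there. *)
Lemma dwork_fun_mulp_neq0 : dwork_fun b M *+ p <> 0.
Proof.
move=> D0; have [L Lp xL] := padic_approx x 3.
have [U _] := red_hypoly_invertible 2 Lp xL.
have DE := expands_dwork_seriesP dwork_funP (eqmod_expn (leqnSn 2) xL).
have p0 : red 2 (p%:R : {poly Zp})%:P = 0.
  rewrite polyC_natr; apply: (invertible_inj U); rewrite mulr0 -DE mulrAC.
  rewrite [red 2 p%:R](rmorph_nat (red 2)) mulr_natr.
  suff -> : proj (dwork_fun b M) 2 *+ p = 0 by rewrite mul0r.
  by rewrite -ilim_projMn D0; apply: raddf0.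
(* The coefficient of degree [k] in [('X * h) ^+ k * p] is [p], as [h] has constant term [1]; but
   [p ^ 2] does not divide [p]. *)
have [k /eqmod_polyP/(_ k)] := red_polyC_eq0 p0.
rewrite mulr_natr coefMn exprMn coefXnM ltnn subnn coef0 -horner_coef0 horner_exp.
rewrite horner_coef0 hpoly_at0 expr1n => /eqmodN.
rewrite oppr0 -[X in eqmod _ _ X]oppr0 => /(padic_opp_nat_eqmod p_pr 2 p 0).1.
rewrite mod0n => /eqP; rewrite -/(dvdn _ _) => /dvdn_leq -/(_ p_gt0).
by rewrite leqNgt expnS expn1 ltn_Pmulr ?prime_gt1.
Qed.

Lemma eps_even m : ~~ odd m -> eps ^+ m = 1 :> padic_t h.
Proof. by move=> m2; rewrite -exprM -signr_odd oddM (negPf m2) andbF. Qed.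

(** As [L = l + p * (L %/ p)], the exponent [L + L %/ p] of the sign is [l + L %/ p * p.+1]; the
    part [l] goes into [(eps * tvar) ^+ l], and [e] is the rest. *)
Lemma dwork_fun_transformation l (e : padic_t h) :
  (l < p)%N -> eqmod p%:R (x + l%:R) 0 ->
  (forall n L, eqmod (p ^ n.+2)%:R x (- L%:R) -> eps ^+ (L %/ p * p.+1) = e) ->
  dwork_fun b M = e * ((eps * tvar) ^+ l * tinv (dwork_fun b M)).
Proof.
(* The precision is at least [2] even at level [0], so that the residue of [L %/ p] modulo [p],
   which decides the sign for [p = 2], is determined by [x]. *)
move=> lp xl eE; apply: ilimP => n; have [L Ln xL] := padic_approx x n.+2.
have Ll : (L %% p)%N = l.
  rewrite -(modn_small lp); apply: (padic_opp_nat_eqmod p_pr 1 L l).1; rewrite expn1.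
  have xL1 : eqmod p%:R x (- L%:R) by rewrite -[p in p%:R]expn1; apply: eqmod_expn xL.
  apply: eqmod_trans (eqmod_sym xL1) _.
  by have := eqmodD xl (eqmod_refl _ (- l%:R)); rewrite addrK add0r.
rewrite (dwork_fun_tinv (leqW (leqnSn n)) Ln xL); congr (proj _ n).
rewrite mulrA Ll; congr (_ * _); rewrite exprMn mulrA -(eE n L xL) -exprD.
by congr (_ ^+ _ * _); rewrite mulnS -Ll -addnA -divn_eq addnC.
Qed.

Lemma dwork_prime_odd n L : p = 2%N -> eqmod (p ^ n.+2)%:R x (- L%:R) ->
  (eqmod 2%:R (dwork_prime x) 1 <-> odd (L %/ p)).
Proof.
move=> p2; have p2R : p%:R = 2%:R :> Zp := congr1 (fun k : nat => k%:R) p2.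
move=> /dwork_prime_eqmod/(eqmod_expn (ltn0Sn n)); rewrite expn1 p2R => x'L.
have m11 : eqmod 2%:R (-1 : Zp) 1 by exists (-1); rewrite mulrN1 opprD addrA subrr sub0r.
have L1 : eqmod 2%:R (- (L %/ p)%:R : Zp) (- 1%:R) <-> odd (L %/ p).
  have := padic_opp_nat_eqmod p_pr 1 (L %/ p) 1; rewrite expn1 p2R.
  by rewrite [X in (_ = _ %[mod X])]p2 !modn2; case: (odd _) => -[H1 H2];
    split=> //; [move=> _; apply: H2|move/H1].
rewrite -L1; split=> [x'1|xm1].
  apply: eqmod_trans (eqmod_sym x'L) _; apply: eqmod_trans x'1 _; exact: eqmod_sym.
by apply: eqmod_trans x'L _; apply: eqmod_trans xm1 m11.
Qed.

End DworkFunction.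

Theorem theorem1p2 (p : nat) (p_pr : prime p) (d : nat) (d_ge1 : (1 <= d)%N)
    (a : rat) (N : nat) (N_ge2 : (2 <= N)%N) (pN : ~~ (p %| N)%N)
    (aN : exists z : int, a = z%:~R / N%:R) (a_gt0 : 0 < a) (a_lt1 : a < 1)
    (l : nat) (l_lt : (l < p)%N)
    (al : eqmod p%:R (ratr a + l%:R : padic p_pr) 0)
    (M : nat)
    (HM : large_enough (fun _ : 'I_d.+1 => ratr a : padic p_pr) M) :
  let b := fun _ : 'I_d.+1 => ratr a : padic p_pr in
  let F := dwork_fun b M in
  let u := ((-1) ^+ d.+1 * tvar) ^+ l : padic_t (hpoly b M) in
  (odd p -> F = u * tinv F) /\
  (p = 2%N ->
    (F = u * tinv F \/ F = - (u * tinv F)) /\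
    (F = - (u * tinv F) <->
       ~~ odd d /\ eqmod 2%:R (dwork_prime (ratr a : padic p_pr)) 1)).
Proof.
move=> b F u; have E := dwork_fun_transformation HM l_lt al.
split=> [p_odd|p2].
  rewrite -[RHS]mul1r; apply: E => n L _; apply: eps_even.
  by rewrite oddM /= p_odd andbF.
have p_even : ~~ odd p by rewrite p2.
(* For [p = 2] the factor [p.+1] is odd, so the sign is [-1] exactly when [d.+1] and [L %/ p] are
   both odd. *)
have [P|nP] := pselect (~~ odd d /\ eqmod 2%:R (dwork_prime (ratr a : padic p_pr)) 1).
  have FE : F = - (u * tinv F).
    rewrite -mulN1r; apply: E => n L xL; have [d_even x'1] := P.
    rewrite -exprM -signr_odd !oddM /= d_even; move: x'1 => /(dwork_prime_odd p2 xL) ->.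
    by rewrite p_even.
  by split; [right|].
have FE : F = u * tinv F.
  rewrite -[RHS]mul1r; apply: E => n L xL.
  rewrite -exprM -signr_odd !oddM /=; case: (boolP (odd d)) => //= d_even.
  by case: (boolP (odd _)) => // /(dwork_prime_odd p2 xL) x'1; case: nP.
split; first by left.
(* Since [F = u * tinv F], the other sign would give [F *+ 2 = 0]. *)
split=> // FN; case: (dwork_fun_mulp_neq0 HM); rewrite [X in _ *+ X]p2 mulr2n.
by rewrite -[dwork_fun _ _]/F {1}FN -FE addNr.
Qed.
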